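(* Let $n\ge 2$, let $\gamma\in C^\infty([a,b];\mathbb{R}^n)$ be an arc-length parametrized curve with unit tangent $T=\gamma'$, and let $\varrho\in C^\infty([a,b];\mathbb{R}_{>0})$ be its bending stiffness. Put $$\mathcal G^{\mathcal B}:=\varrho T'''+3\varrho\langle T'',T'\rangle T+\tfrac32\varrho\langle T',T'\rangle T'+\varrho''T'+\varrho'\big(2T''+\tfrac32\langle T',T'\rangle T\big).$$ Then $\gamma$ is an elastic curve with bending stiffness $\varrho$ if and only if there is a function $\Lambda\in C^\infty([a,b];\mathbb{R})$ such that $$\mathcal G^{\mathcal B}-2\Lambda'T-2\Lambda T'=0.$$ Equivalently, in terms of $T$: there is a function $\Lambda\in C^\infty([a,b];\mathbb{R})$ such that $$\varrho T'''+3\varrho\langle T',T''\rangle T+\tfrac32\varrho\langle T',T'\rangle T'+\varrho''T'+2\varrho'T''+\tfrac32\varrho'\langle T',T'\rangle T-\Lambda'T-\Lambda T'=0;$$ or equivalently, in terms of $\gamma$: there is a function $\Lambda\in C^\infty([a,b];\mathbb{R})$ such that $$\varrho\gamma''''+3\varrho\langle\gamma''',\gamma''\rangle\gamma'+\tfrac32\varrho\langle\gamma'',\gamma''\rangle\gamma''+\varrho''\gamma''+2\varrho'\gamma'''+\tfrac32\varrho'\langle\gamma'',\gamma''\rangle\gamma'-\Lambda'\gamma'-\Lambda\gamma''=0.$$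
   Context: A curve is a map $\gamma\in C^\infty([a,b];\mathbb{R}^n)$ with $\gamma'\ne0$ everywhere; it is arc-length parametrized if $|\gamma'|\equiv1$. For a function $g$ along $\gamma$, $\frac{dg}{ds}:=g'/|\gamma'|$ and $ds=|\gamma'|\,dx$; $T:=\frac{d\gamma}{ds}$. The bending energy of $\gamma$ with bending stiffness $\varrho\in C^\infty([a,b];\mathbb{R}_{>0})$ is $\mathcal B_\varrho(\gamma):=\frac12\int_a^b\varrho\,\langle\frac{dT}{ds},\frac{dT}{ds}\rangle\,ds$ ($\varrho$ is a fixed function on $[a,b]$, not varied). A smooth variation of $\gamma$ is a smooth one-parameter family $\gamma_t$, $t\in[-\epsilon,\epsilon]$, with $\gamma_0=\gamma$; its variational vector field is $\mathring\gamma:=\frac{d}{dt}|_{t=0}\gamma_t$, and for a functional $\mathcal F$, $d\mathcal F(\mathring\gamma):=\frac{d}{dt}|_{t=0}\mathcal F(\gamma_t)$. $C_0^\infty([a,b];\mathbb{R}^n)$ denotes the smooth maps with compact support in the interior of $[a,b]$. Variations and variational vector fields are treated as synonyms. An arc-length parametrized curve $\gamma$ with bending stiffness $\varrho$ is called elastic with bending stiffness $\varrho$ if it is a critical point of $\mathcal B_\varrho$ under all variations $\mathring\gamma\in C_0^\infty([a,b];\mathbb{R}^n)$ constraining the arc-length, i.e. $d\mathcal B_\varrho(\mathring\gamma)=0$ for all $\mathring\gamma\in C_0^\infty([a,b];\mathbb{R}^n)$ satisfying pointwise $\langle\mathring\gamma',\gamma'\rangle=0$. *)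

(* Defs.v *)
From HB Require Import structures.
From mathcomp Require Import all_boot all_order all_algebra.
From mathcomp Require Import all_classical all_reals all_analysis.

Set Implicit Arguments.
Unset Strict Implicit.
Unset Printing Implicit Defensive.

Import Order.TTheory GRing.Theory Num.Theory.
Import numFieldNormedType.Exports.

Local Open Scope classical_set_scope.
Local Open Scope ring_scope.

(** Functions on [[a, b]] are total functions on [R] of which only the values
    on [[a, b]] matter.  Derivatives are taken within [[a, b]], hence are
    one-sided at the endpoints, and are meaningful only when [a < b]. *)

Definition derivable_within (R : realType) (V : normedModType R) (a b : R)
    (f : R -> V) (x : R) : Prop :=
  cvg ((fun y => (y - x)^-1 *: (f y - f x)) @ within `[a, b] x^').

Definition derive_within (R : realType) (V : normedModType R) (a b : R)
    (f : R -> V) (x : R) : V :=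
  lim ((fun y => (y - x)^-1 *: (f y - f x)) @ within `[a, b] x^').

Definition nderive_within (R : realType) (V : normedModType R) (a b : R)
    (k : nat) (f : R -> V) : R -> V :=
  iter k (derive_within a b) f.

Definition nderive_within_R (R : realType) (a b : R) (k : nat) (f : R -> R) :
    R -> R :=
  nderive_within a b k (f : R -> R^o).

Definition smooth (R : realType) (V : normedModType R) (a b : R)
    (f : R -> V) : Prop :=
  forall (k : nat) (x : R), x \in `[a, b] ->
    derivable_within a b (nderive_within a b k f) x.

(** [C^k] functions of [(t, x)] on [[c, d] * [a, b]]. *)
Fixpoint Ck_rectangle (R : realType) (V : normedModType R) (c d a b : R)
    (k : nat) (f : R -> R -> V) : Prop :=
  {within `[c, d] `*` `[a, b], continuous (fun p : R * R => f p.1 p.2)} /\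
  match k with
  | 0 => True
  | k'.+1 =>
    [/\ forall t x : R, t \in `[c, d] -> x \in `[a, b] ->
          derivable_within c d (f ^~ x) t /\ derivable_within a b (f t) x,
        Ck_rectangle c d a b k'
          (fun t x => derive_within c d (f ^~ x) t) &
        Ck_rectangle c d a b k'
          (fun t x => derive_within a b (f t) x)]
  end.

Definition smooth_rectangle (R : realType) (V : normedModType R) (c d a b : R)
    (f : R -> R -> V) : Prop :=
  forall k : nat, Ck_rectangle c d a b k f.

Definition compactly_supported (R : realType) (V : normedModType R) (a b : R)
    (f : R -> V) : Prop :=
  let S := closure [set x | x \in `[a, b] /\ f x != 0] in
  compact S /\ S `<=` `]a, b[.

(** The library norm [`|v|] on ['rV[R]_n] is the sup norm; it induces the same
    topology, but lengths have to be measured with [enorm]. *)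
Definition dot (R : realType) (n : nat) (u v : 'rV[R]_n) : R :=
  \sum_(i < n) u 0 i * v 0 i.

Definition enorm (R : realType) (n : nat) (v : 'rV[R]_n) : R :=
  Num.sqrt (dot v v).

Definition curve (R : realType) (n : nat) (a b : R) (gamma : R -> 'rV[R]_n) :
    Prop :=
  smooth a b gamma /\
  (forall x : R, x \in `[a, b] -> derive_within a b gamma x != 0).

Definition arc_length_parametrized (R : realType) (n : nat) (a b : R)
    (gamma : R -> 'rV[R]_n) : Prop :=
  curve a b gamma /\
  (forall x : R, x \in `[a, b] -> enorm (derive_within a b gamma x) = 1).

Definition bending_stiffness (R : realType) (a b : R) (rho : R -> R) : Prop :=
  smooth a b (rho : R -> R^o) /\ (forall x : R, x \in `[a, b] -> 0 < rho x).

Definition arc_derive (R : realType) (n : nat) (a b : R)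
    (gamma g : R -> 'rV[R]_n) (x : R) : 'rV[R]_n :=
  (enorm (derive_within a b gamma x))^-1 *: derive_within a b g x.

Definition unit_tangent (R : realType) (n : nat) (a b : R)
    (gamma : R -> 'rV[R]_n) : R -> 'rV[R]_n :=
  arc_derive a b gamma gamma.

Definition bending_energy (R : realType) (n : nat) (a b : R) (rho : R -> R)
    (gamma : R -> 'rV[R]_n) : R :=
  let kappa := arc_derive a b gamma (unit_tangent a b gamma) in
  2^-1 * \int[@lebesgue_measure R]_(x in `[a, b])
    (rho x * dot (kappa x) (kappa x) * enorm (derive_within a b gamma x)).

Definition smooth_variation (R : realType) (n : nat) (a b eps : R)
    (gamma : R -> 'rV[R]_n) (Gamma : R -> R -> 'rV[R]_n) : Prop :=
  [/\ 0 < eps,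
      smooth_rectangle (- eps) eps a b Gamma,
      forall t : R, t \in `[- eps, eps] -> curve a b (Gamma t) &
      forall x : R, x \in `[a, b] -> Gamma 0 x = gamma x].

(** [dF(W) = l]: every variation of [gamma] with variational vector field [W]
    gives [d/dt|_0 F(Gamma_t) = l]. *)
Definition first_variation (R : realType) (n : nat) (a b : R)
    (F : (R -> 'rV[R]_n) -> R) (gamma W : R -> 'rV[R]_n) (l : R) : Prop :=
  forall (eps : R) (Gamma : R -> R -> 'rV[R]_n),
    smooth_variation a b eps gamma Gamma ->
    (forall x : R, x \in `[a, b] -> derive1 (Gamma ^~ x) 0 = W x) ->
    is_derive (0 : R^o) (1 : R^o) (fun t => F (Gamma t) : R^o) l.

Definition elastic (R : realType) (n : nat) (a b : R) (rho : R -> R)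
    (gamma : R -> 'rV[R]_n) : Prop :=
  arc_length_parametrized a b gamma /\
  (forall W : R -> 'rV[R]_n,
    smooth a b W -> compactly_supported a b W ->
    (forall x : R, x \in `[a, b] ->
      dot (derive_within a b W x) (derive_within a b gamma x) = 0) ->
    first_variation a b (bending_energy a b rho) gamma W 0).

Definition bending_gradient (R : realType) (n : nat) (a b : R)
    (rho : R -> R) (T : R -> 'rV[R]_n) (x : R) : 'rV[R]_n :=
  let T1 := nderive_within a b 1 T x in
  let T2 := nderive_within a b 2 T x in
  let T3 := nderive_within a b 3 T x in
  let rho1 := nderive_within_R a b 1 rho x in
  let rho2 := nderive_within_R a b 2 rho x in
  rho x *: T3 + (3 * rho x * dot T2 T1) *: T x
  + (3 / 2 * rho x * dot T1 T1) *: T1 + rho2 *: T1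
  + rho1 *: (2 *: T2 + (3 / 2 * dot T1 T1) *: T x).

(* Main.v *)
(** Along a variation with field [W] such that [<W', gamma'> = 0], the energy
    density [rho (|w|^2 |v|^2 - <v, w>^2) / |v|^5], with [v] and [w] the velocity
    and the acceleration, has derivative [2 rho <T', W''>] at time 0.  Hence
    [gamma] is elastic iff [\int rho <T', W''> = 0] for all admissible [W], that
    is, iff [\int <(rho T')', Y> = 0] for all [Y = W'] that are compactly
    supported, orthogonal to [T] and of zero mean.  The zero mean condition is a
    finite-dimensional constraint with a constant Lagrange multiplier [c], and
    testing [(rho T')' - c] against a bump function times its normal part gives
    [(rho T')' = c + m T].  The bending gradient is the derivative of
    [(rho T')' + 3/2 rho <T', T'> T], so this amounts to the equation of the
    theorem with [2 Lambda = m + 3/2 rho <T', T'>]. *)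

Require Import Defs.
From HB Require Import structures.
From mathcomp Require Import all_boot all_order all_algebra.
From mathcomp Require Import all_classical all_reals all_analysis.
From mathcomp Require Import ring lra.

Set Implicit Arguments.
Unset Strict Implicit.
Unset Printing Implicit Defensive.

Import Order.TTheory GRing.Theory Num.Theory.
Import numFieldNormedType.Exports.

Local Open Scope classical_set_scope.
Local Open Scope ring_scope.

(** * Derivatives within a segment *)

(** Criticality quantifies over every variation with field W, so the energy must be differentiated
    along an arbitrary smooth family, with a result that depends on W alone. The obstacle is that
    the integrand contains x-derivatives of the family up to order two, while W is a t-derivative:
    at time 0, d/dt has to pass through two derivatives that are one-sided at the ends. Once this is
    settled, a single variation per field is enough to exploit criticality, namely gamma + t W:
    since <W', gamma'> = 0, its squared speed is 1 + t^2 |W'|^2, so every member is a curve even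
    though arc length is kept only to first order. The multiplier c comes from pure linear algebra:
    a functional that vanishes on the common kernel of finitely many functionals is a combination of
    them, so the test space needs no topology. The function m is not produced by an existence
    argument either: it is the tangential component <(rho T')' - c, T>, hence smooth. *)

Lemma cvg_near_eq (T : Type) (U : topologicalType) (F : set_system T)
    (f g : T -> U) (l : U) : Filter F ->
  f @ F --> l -> (\forall y \near F, f y = g y) -> g @ F --> l.
Proof. by move=> FF fl fg; apply: cvg_trans fl; exact: near_eq_cvg. Qed.

Section derivative_within.
Context (R : realType) (a b : R).
Hypothesis hab : a < b.

(** A relation that carries existence and value together, so that the calculus rules compose without
    side conditions on [lim]. *)
Definition has_dw (V : normedModType R) (f : R -> V) (x : R) (l : V) : Prop :=
  (fun y => (y - x)^-1 *: (f y - f x)) @ within `[a, b] x^' --> l.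

Lemma within_dnbhs_proper (x : R) : x \in `[a, b] ->
  ProperFilter (within `[a, b] x^').
Proof.
rewrite in_itv /= => /andP[ax xb]; apply: Build_ProperFilter_ex => P.
move=> -[e /= e0 eP].
pose d := Num.min (e / 2) ((b - a) / 2).
have d0 : 0 < d by rewrite lt_min !divr_gt0// subr_gt0.
have de : d < e by rewrite gt_min; apply/orP; left; lra.
have db : d <= (b - a) / 2 by rewrite ge_min lexx orbT.
(* Step from [x] towards the farther end: as [d] is at most half the length, the new point stays in
   the segment. *)
have [xm|xm] := leP x ((a + b) / 2).
- exists (x + d); apply: eP => /=.
  + by rewrite opprD addNKr normrN gtr0_norm.
  + by rewrite gt_eqF// ltrDl.
  + by rewrite in_itv /=; apply/andP; split; lra.
- exists (x - d); apply: eP => /=.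
  + by rewrite opprB addrC subrK gtr0_norm.
  + by rewrite lt_eqF// gtrBl.
  + by rewrite in_itv /=; apply/andP; split; lra.
Qed.

Lemma near_within_dnbhs (x : R) :
  \forall y \near within `[a, b] x^', y \in `[a, b] /\ y != x.
Proof. by exists 1 => //= y _ yx yab; split. Qed.

Section general.
Variable V : normedModType R.
Implicit Types f g : R -> V.

Lemma has_dwP f x l : x \in `[a, b] -> has_dw f x l ->
  derivable_within a b f x /\ derive_within a b f x = l.
Proof.
move=> /within_dnbhs_proper PF fl; split; first by apply/cvg_ex; exists l.
exact: (cvg_lim (@norm_hausdorff _ _) fl).
Qed.

Lemma has_dwE f x l : x \in `[a, b] -> has_dw f x l ->
  derive_within a b f x = l.
Proof. by move=> xab /(has_dwP xab)[]. Qed.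

Lemma has_dw_uniq f x l m : x \in `[a, b] -> has_dw f x l -> has_dw f x m ->
  l = m.
Proof. by move=> xab /(has_dwE xab) <- /(has_dwE xab) <-. Qed.

Lemma has_dw_eq f g x l : x \in `[a, b] -> {in `[a, b], f =1 g} ->
  has_dw f x l -> has_dw g x l.
Proof.
move=> xab fg /cvg_near_eq; apply.
near=> y.
have [yab _] : y \in `[a, b] /\ y != x by near: y; exact: near_within_dnbhs.
by rewrite !fg.
Unshelve. all: by end_near. Qed.

(** No derivability is assumed: the two image filters coincide, so their [lim] agree even where no
    limit exists. *)
Lemma eq_derive_within f g : {in `[a, b], f =1 g} ->
  {in `[a, b], derive_within a b f =1 derive_within a b g}.
Proof.
move=> fg x xab; rewrite /derive_within; congr lim; apply/seteqP; split.
  apply: near_eq_cvg; near=> y.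
  have [yab _] : y \in `[a, b] /\ y != x by near: y; exact: near_within_dnbhs.
  by rewrite !fg.
apply: near_eq_cvg; near=> y.
have [yab _] : y \in `[a, b] /\ y != x by near: y; exact: near_within_dnbhs.
by rewrite !fg.
Unshelve. all: by end_near. Qed.

Lemma has_dw_cst (v : V) x : has_dw (fun=> v) x 0.
Proof.
rewrite /has_dw; under eq_fun do rewrite subrr scaler0.
exact: cvg_cst.
Qed.

Lemma has_dwD f g x l m : has_dw f x l -> has_dw g x m ->
  has_dw (fun y => f y + g y) x (l + m).
Proof.
move=> fl gm; rewrite /has_dw.
under eq_fun do rewrite opprD addrACA scalerDr.
exact: cvgD.
Qed.

Lemma has_dwN f x l : has_dw f x l -> has_dw (fun y => - f y) x (- l).
Proof.
move=> fl; rewrite /has_dw.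
under eq_fun do rewrite -opprD scalerN.
exact: cvgN.
Qed.

Lemma has_dwB f g x l m : has_dw f x l -> has_dw g x m ->
  has_dw (fun y => f y - g y) x (l - m).
Proof. by move=> fl gm; apply: has_dwD => //; apply: has_dwN. Qed.

Lemma has_dw_sum (I : Type) (r : seq I) (F : I -> R -> V) (L : I -> V) x :
  (forall i, has_dw (F i) x (L i)) ->
  has_dw (fun y => \sum_(i <- r) F i y) x (\sum_(i <- r) L i).
Proof.
move=> FL; elim: r => [|i r ih].
  rewrite big_nil (_ : (fun y => _) = fun=> 0); first exact: has_dw_cst.
  by apply/funext => y; rewrite big_nil.
rewrite big_cons (_ : (fun y => _) = fun y => F i y + \sum_(j <- r) F j y).
  exact: has_dwD.
by apply/funext => y; rewrite big_cons.
Qed.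

Lemma has_dw_cvg f x l : has_dw f x l -> f @ within `[a, b] x^' --> f x.
Proof.
move=> fl.
have id0 : (fun y : R => y - x) @ within `[a, b] x^' --> (0 : R).
  rewrite -(subrr x); apply: cvgB; last exact: cvg_cst.
  by move=> P [e /= e0 eP]; exists e => //= y yx _ _; exact: eP.
have : (fun y => (y - x) *: ((y - x)^-1 *: (f y - f x)) + f x)
    @ within `[a, b] x^' --> 0 *: l + f x.
  by apply: cvgD; [exact: cvgZ|exact: cvg_cst].
rewrite scale0r add0r; move=> /cvg_near_eq; apply.
near=> y.
have [_ yx] : y \in `[a, b] /\ y != x by near: y; exact: near_within_dnbhs.
by rewrite /= /fctE scalerA divff ?subr_eq0// scale1r subrK.
Unshelve. all: by end_near. Qed.

Lemma has_dw_continuous f (df : R -> V) :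
  (forall x, x \in `[a, b] -> has_dw f x (df x)) ->
  {within `[a, b], continuous f}.
Proof.
move=> fdf; apply/subspace_continuousP => x xab.
have /has_dw_cvg fx := fdf x xab.
move=> P Px; move: (Px) => /fx; rewrite /within /=.
move=> [e /= e0 eP]; exists e => //= y yx yab.
have [->|yx'] := eqVneq y x; first exact: nbhs_singleton Px.
exact: eP.
Qed.

End general.

Lemma has_dw_id x : has_dw (fun y : R => y : R^o) x (1 : R^o).
Proof.
rewrite /has_dw; apply: (@cvg_near_eq _ _ _ (fun=> 1 : R^o)); first exact: cvg_cst.
near=> y.
have [_ yx] : y \in `[a, b] /\ y != x by near: y; exact: near_within_dnbhs.
by rewrite /= /GRing.scale /= mulVf ?subr_eq0.
Unshelve. all: by end_near. Qed.

Lemma has_dwZ (V : normedModType R) (k : R -> R^o) (f : R -> V) x m l :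
  has_dw k x m -> has_dw f x l ->
  has_dw (fun y => k y *: f y) x (m *: f x + k x *: l).
Proof.
move=> km fl; rewrite /has_dw.
(* Leibniz splitting. The first term takes [f] at [y], so its limit uses the continuity given by
   [has_dw_cvg]. *)
have : (fun y => ((y - x)^-1 *: (k y - k x)) *: f y +
      k x *: ((y - x)^-1 *: (f y - f x)))
    @ within `[a, b] x^' --> m *: f x + k x *: l.
  apply: cvgD; first by apply: cvgZ => //; exact: has_dw_cvg fl.
  by apply: cvgZ => //; exact: cvg_cst.
move=> /cvg_near_eq; apply; near=> y => /=.
rewrite scalerA [k x * _]mulrC -[(_ *: (k y - k x)) *: f y]scalerA -scalerA.
by rewrite -scalerDr scalerBl scalerBr addrA subrK.
Unshelve. all: by end_near. Qed.

Lemma has_dwM (k f : R -> R^o) x m l : has_dw k x m -> has_dw f x l ->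
  has_dw (fun y => k y * f y : R^o) x (m * f x + k x * l : R^o).
Proof. exact: has_dwZ. Qed.

Lemma has_dwZr (V : normedModType R) (k : R) (f : R -> V) x l :
  has_dw f x l -> has_dw (fun y => k *: f y) x (k *: l).
Proof.
move=> fl; have := has_dwZ (@has_dw_cst R^o k x) fl.
by rewrite scale0r add0r.
Qed.

Lemma has_dwMr (k : R) (f : R -> R^o) x l :
  has_dw f x l -> has_dw (fun y => k * f y : R^o) x (k * l : R^o).
Proof. exact: has_dwZr. Qed.

(** At [k = 0] the truncated exponent [k.-1] does no harm, because the factor [k%:R] is 0. *)
Lemma has_dwX (f : R -> R^o) k x l : has_dw f x l ->
  has_dw (fun y => f y ^+ k : R^o) x (k%:R * f x ^+ k.-1 * l : R^o).
Proof.
move=> fl; elim: k => [|k ih]; first by rewrite !mul0r; exact: has_dw_cst.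
have -> : (fun y => f y ^+ k.+1) = (fun y => f y * f y ^+ k).
  by apply/funext => y; rewrite exprS.
suff -> : k.+1%:R * f x ^+ k.+1.-1 * l =
    l * f x ^+ k + f x * (k%:R * f x ^+ k.-1 * l) by exact: has_dwM.
by case: k {ih} => [|k]; rewrite /= ?exprS ?expr0; ring.
Qed.

Lemma has_dwV (f : R -> R^o) x l : f x != 0 -> has_dw f x l ->
  has_dw (fun y => (f y)^-1 : R^o) x (- (l / f x ^+ 2) : R^o).
Proof.
move=> fx0 fl.
have cf := has_dw_cvg fl.
have : (fun y => - (((y - x)^-1 * (f y - f x)) * ((f y)^-1 * (f x)^-1)))
    @ within `[a, b] x^' --> - (l * ((f x)^-1 * (f x)^-1)).
  apply: cvgN; apply: cvgM => //; apply: cvgM; last exact: cvg_cst.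
  exact: cvgV.
rewrite /has_dw -expr2 exprVn; move=> /cvg_near_eq; apply.
have nz : \forall y \near within `[a, b] x^', f y != 0.
  by apply: cvgr_neq0 fx0; exact: cf.
near=> y => /=.
have fy0 : f y != 0 by near: y.
rewrite /GRing.scale /=.
by rewrite -mulrA -mulrN; congr (_ * _); field; rewrite fy0 fx0.
Unshelve. all: by end_near. Qed.

Lemma has_dw_sqrt (f : R -> R^o) x l : 0 < f x -> has_dw f x l ->
  has_dw (fun y => Num.sqrt (f y) : R^o) x (l / (2 * Num.sqrt (f x)) : R^o).
Proof.
move=> fx0 fl.
have cf := has_dw_cvg fl.
have cs : (fun y => Num.sqrt (f y)) @ within `[a, b] x^' --> Num.sqrt (f x).
  apply: (cvg_comp _ _ cf); exact: sqrt_continuous.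
have s0 : 0 < Num.sqrt (f x) by rewrite sqrtr_gt0.
have s20 : Num.sqrt (f x) + Num.sqrt (f x) != 0 by rewrite gt_eqF// addr_gt0.
(* The quotient of the root is the quotient of [f] divided by the sum of the two roots. *)
have : (fun y => ((y - x)^-1 * (f y - f x)) *
      (Num.sqrt (f y) + Num.sqrt (f x))^-1)
    @ within `[a, b] x^' --> l * (Num.sqrt (f x) + Num.sqrt (f x))^-1.
  apply: cvgM => //; apply: cvgV => //; apply: cvgD => //; exact: cvg_cst.
rewrite /has_dw mulr_natl mulr2n; move=> /cvg_near_eq; apply.
have nz : \forall y \near within `[a, b] x^', 0 < f y.
  by apply: (cvgr_gt (f x)) fx0; exact: cf.
near=> y => /=.
have fy0 : 0 < f y by near: y.
have sy0 : 0 < Num.sqrt (f y) by rewrite sqrtr_gt0.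
rewrite /GRing.scale /= -mulrA; congr (_ * _).
have -> : f y - f x = (Num.sqrt (f y) - Num.sqrt (f x)) *
    (Num.sqrt (f y) + Num.sqrt (f x)) by rewrite -subr_sqr !sqr_sqrtr// ltW.
by rewrite mulfK// gt_eqF// addr_gt0.
Unshelve. all: by end_near. Qed.

(** Near an interior point the restriction to the segment is void, so the limit is two-sided. *)
Lemma has_dw_dnbhs (V : normedModType R) (f : R -> V) x (l : V) :
  x \in `]a, b[ -> has_dw f x l -> h^-1 *: (f (h + x) - f x) @[h --> 0^'] --> l.
Proof.
move=> xab fl.
have xn : \forall y \near x, y \in `]a, b[ by exact: near_in_itvoo.
move=> P /fl [e /= e0 eP]; move: xn => [d /= d0 dP].
exists (Num.min e d) => /=; first by rewrite lt_min e0.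
move=> h /=; rewrite sub0r normrN lt_min => /andP[he hd] h0.
have := eP (h + x); rewrite /= addrK; apply.
- by rewrite opprD addrCA subrr addr0 normrN.
- by rewrite -subr_eq0 addrK.
- apply: subset_itv_oo_cc; apply: dP => /=.
  by rewrite opprD addrCA subrr addr0 normrN.
Qed.

Lemma has_dw_interior (f : R -> R^o) x (l : R^o) : x \in `]a, b[ -> has_dw f x l ->
  is_derive (x : R^o) (1 : R^o) f l.
Proof.
move=> xab /(has_dw_dnbhs xab) H.
have E : (fun h : R => h^-1 *: ((f \o shift x) (h *: (1 : R^o)) - f x)) =
    (fun h => h^-1 *: (f (h + x) - f x)).
  by apply/funext => h; rewrite /= [h *: _]mulr1.
apply: DeriveDef; first by apply/cvg_ex; exists l; rewrite E.
by rewrite /derive E; exact: (cvg_lim (@norm_hausdorff _ _) H).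
Qed.

Lemma is_derive_has_dw (f : R -> R^o) x (l : R^o) :
  is_derive (x : R^o) (1 : R^o) f l -> has_dw f x l.
Proof.
move=> [/cvg_ex[m] fm]; have fl : derive f x 1 = m.
  exact: (cvg_lim (@norm_hausdorff _ _) fm).
rewrite fl => ml; rewrite ml in fm * => {m ml fl}.
move=> P /fm [e /= e0 eP]; exists e => //= y yx ynx _.
have := eP (y - x); rewrite /= [(y - x) *: _]mulr1 subrK; apply.
- by rewrite sub0r opprB.
- by rewrite subr_eq0.
Qed.

End derivative_within.

(** * Integrals and parameters *)

Lemma has_dw_subitv (R : realType) (a b c d : R) (V : normedModType R)
    (f : R -> V) (x : R) (l : V) :
  `[c, d] `<=` `[a, b] -> has_dw a b f x l -> has_dw c d f x l.
Proof.
move=> sub fl P /fl [e /= e0 eP]; exists e => //= y yx ynx ycd.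
by apply: eP => //; exact: sub.
Qed.

Section integral.
Context (R : realType) (a b : R).
Hypothesis hab : a < b.
Notation mu := (@lebesgue_measure R).

Lemma has_dw0_cst (f : R -> R^o) : {within `[a, b], continuous f} ->
  (forall x, x \in `]a, b[ -> has_dw a b f x (0 : R^o)) ->
  forall x, x \in `[a, b] -> f x = f a.
Proof.
move=> cf f0 x xab; have ax : a <= x by rewrite (itvP xab).
have [c _] : exists2 c, c \in `[a, x] & f x - f a = 0 * (x - a).
  apply: (@MVT_segment R f (fun=> 0)) => //.
    move=> y yax; have yab : y \in `]a, b[.
      by move: y yax; apply: subset_itvl; rewrite bnd_simp (itvP xab).
    exact: (has_dw_interior yab (f0 _ yab)).
  apply: continuous_subspaceW cf.
  by apply: subset_itvl; rewrite bnd_simp (itvP xab).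
by rewrite mul0r => /eqP; rewrite subr_eq0 => /eqP.
Qed.

Lemma within_continuous_integrable (f : R -> R) :
  {within `[a, b], continuous f} -> mu.-integrable `[a, b] (EFin \o f).
Proof.
by move=> cf; apply: continuous_compact_integrable => //; exact: segment_compact.
Qed.

Lemma Rintegral_FTC2 (f F : R -> R^o) :
  {within `[a, b], continuous f} ->
  (forall x, x \in `[a, b] -> has_dw a b F x (f x)) ->
  \int[mu]_(x in `[a, b]) f x = F b - F a.
Proof.
move=> cf Ff; rewrite /Rintegral (@continuous_FTC2 _ f F)//.
  have /(continuous_within_itvP _ hab)[_ Fa Fb] := has_dw_continuous Ff.
  split => // x xab; have xab' := subset_itv_oo_cc xab.
  by have [] := has_dw_interior xab (Ff _ xab').
move=> x xab; have xab' := subset_itv_oo_cc xab.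
rewrite derive1E.
by have [_ ->] := has_dw_interior xab (Ff _ xab').
Qed.

Lemma antiderivative (f : R -> R^o) : {within `[a, b], continuous f} ->
  exists F : R -> R^o, forall x, x \in `[a, b] -> has_dw a b F x (f x).
Proof.
(* [p] clamps the line onto the segment: [f \o p] is continuous on all of [R] and agrees with [f] on
   the segment. *)
move=> cf; pose p x := Num.max a (Num.min x b).
have pab x : p x \in `[a, b].
  by rewrite in_itv /= le_max lexx /= ge_max (ltW hab) ge_min lexx orbT.
have pE x : x \in `[a, b] -> p x = x.
  by move=> xab; rewrite /p min_l ?max_r// (itvP xab).
have cp : continuous p.
  apply: (@max_fun_continuous _ _ _ (fun=> a) (fun x => Num.min x b)).
    exact: cst_continuous.
  apply: (@min_fun_continuous _ _ _ id (fun=> b)); last exact: cst_continuous.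
  by move=> x; exact: cvg_id.
have cg : continuous (f \o p).
  move=> x P Px; move/subspace_continuousP : cf => /(_ (p x) (pab x) P Px).
  move=> /(cp x) H; have {}H : \forall y \near x, `[a, b]%classic (p y) -> P (f (p y)).
    exact: H.
  by apply: filterS H => y; apply; exact: pab.
(* Starting the integral at [a - 1], and working up to [b + 1], makes even [a] and [b] interior
   points, where the fundamental theorem gives a two-sided derivative. *)
exists (fun x => \int[mu]_(t in `[a - 1, x]) (f \o p) t) => x xab.
have xab' := xab; rewrite in_itv /= in xab'; case/andP: xab' => ax xb.
apply: is_derive_has_dw.
have xu : x < b + 1 by lra.
have [|||D1 D2] := @continuous_FTC1_closed R (f \o p) (a - 1) x (b + 1) xu.
- apply: continuous_compact_integrable; first exact: segment_compact.
  exact: continuous_subspaceT cg.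
- by lra.
- exact: cg.
by apply: DeriveDef => //; rewrite -derive1E D2 /= pE.
Qed.


(** A primitive of [f] is constant on the whole segment, so its derivative vanishes at the endpoints
    too. *)
Lemma within_continuous_eq0 (f : R -> R^o) : {within `[a, b], continuous f} ->
  {in `]a, b[, f =1 fun=> 0} -> {in `[a, b], f =1 fun=> 0}.
Proof.
move=> cf f0 x xab; have [F Ff] := antiderivative cf.
have cF := has_dw0_cst (has_dw_continuous Ff).
apply: (has_dw_uniq hab xab (Ff x xab)).
apply: (@has_dw_eq R a b R^o (fun=> F a)) => //; last exact: has_dw_cst.
move=> y yab; rewrite cF// => z zab.
by have := Ff z (subset_itv_oo_cc zab); rewrite f0.
Qed.

(** A primitive of [f] is nondecreasing with equal end values, hence constant, and [f] is its
    derivative. *)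
Lemma Rintegral_ge0_eq0 (f : R -> R^o) : {within `[a, b], continuous f} ->
  (forall x, x \in `[a, b] -> 0 <= f x) -> \int[mu]_(x in `[a, b]) f x = 0 ->
  {in `[a, b], f =1 fun=> 0}.
Proof.
move=> cf f0 intf x xab; have [F Ff] := antiderivative cf.
have cF := has_dw_continuous Ff.
have dF y : y \in `]a, b[ -> is_derive (y : R^o) (1 : R^o) F (f y).
  by move=> yab; apply: (has_dw_interior yab); exact: Ff (subset_itv_oo_cc yab).
have mF : {in `[a, b] &, {homo F : y z / y <= z}}.
  apply: ger0_derive1_le_cc => // y yab; have [// _ E] := dF y yab.
  by rewrite derive1E E f0// subset_itv_oo_cc.
have aab : a \in `[a, b] by rewrite in_itv /= lexx ltW.
have bab : b \in `[a, b] by rewrite in_itv /= lexx ltW.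
have Fba : F b = F a.
  by apply/eqP; rewrite -subr_eq0 -(Rintegral_FTC2 cf Ff) intf.
apply: (has_dw_uniq hab xab (Ff x xab)).
apply: (@has_dw_eq R a b R^o (fun=> F a)) => //; last exact: has_dw_cst.
move=> y yab /=; apply/eqP; rewrite eq_le -{2}Fba !mF// (itvP yab)//.
Qed.

End integral.

Section parameter.
Context (R : realType) (c d a b : R).
Notation mu := (@lebesgue_measure R).

Lemma within_rectangle_slice (V : topologicalType) (f : R -> R -> V) t :
  t \in `[c, d] ->
  {within `[c, d] `*` `[a, b], continuous (fun p : R * R => f p.1 p.2)} ->
  {within `[a, b], continuous (f t)}.
Proof.
move=> tcd /subspace_continuousP cf; apply/subspace_continuousP => x xab P Px.
have [[U W] /= [tU xW] UW] := cf (t, x) (conj tcd xab) P Px.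
apply: filterS xW => y Wy yab.
by apply: (UW (t, y)) => //; split => //=; exact: nbhs_singleton tU.
Qed.

Lemma is_derive_Rintegral (f ft : R -> R -> R^o) (t : R) :
  (forall s x, s \in `[c, d] -> x \in `[a, b] ->
     has_dw c d (f ^~ x) s (ft s x)) ->
  (forall s, s \in `[c, d] -> {within `[a, b], continuous (f s)}) ->
  {within `[c, d] `*` `[a, b], continuous (fun p : R * R => ft p.1 p.2)} ->
  t \in `]c, d[ ->
  is_derive (t : R^o) (1 : R^o)
    (fun s => \int[mu]_(x in `[a, b]) f s x : R^o)
    (\int[mu]_(x in `[a, b]) ft t x : R^o).
Proof.
move=> ftE cf cft tcd.
have dE s x : s \in `]c, d[ -> x \in `[a, b] ->
    is_derive (s : R^o) (1 : R^o) (f ^~ x) (ft s x).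
  by move=> scd xab; apply: (has_dw_interior scd); apply: ftE => //;
    exact: subset_itv_oo_cc.
have pE s x : s \in `]c, d[ -> x \in `[a, b] -> partial1of2 f s x = ft s x.
  by move=> scd xab; rewrite partial1of2E; have [_ ->] := dE _ _ scd xab.
(* The t-derivative is continuous on a compact rectangle, hence bounded there, and a constant serves
   as the dominating function. *)
have cK : compact (`[c, d] `*` `[a, b] : set (R * R)).
  by apply: compact_setX; exact: segment_compact.
have [M [_ hM]] := compact_bounded (continuous_compact cft cK).
pose G := fun _ : R => `|M| + 1.
have G0 x : 0 <= G x by rewrite addr_ge0.
have intG : mu.-integrable `[a, b] (EFin \o G).
  by apply: within_continuous_integrable; exact/continuous_subspaceT/cst_continuous.
have H := @cvg_differentiation_under_integral R _ _ mu f `[a, b]%classic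
  (measurable_itv _) t c d tcd.
have intf s : `]c, d[%classic s -> mu.-integrable `[a, b] (EFin \o f s).
  move=> scd; apply: within_continuous_integrable; apply: cf.
  exact: subset_itv_oo_cc.
have derf s x : `]c, d[%classic s -> `[a, b]%classic x -> derivable (f ^~ x) s 1.
  by move=> scd xab; have [] := dE _ _ scd xab.
have ub s x : `]c, d[%classic s -> `[a, b]%classic x ->
    `|partial1of2 f s x| <= G x.
  move=> scd xab; rewrite pE//; apply: hM.
    by rewrite (le_lt_trans (ler_norm M))// ltrDl.
  by exists (s, x) => //; split => //; exact: subset_itv_oo_cc.
have {}H := H intf derf G G0 intG ub.
have E : (fun h : R => h^-1 *: (((fun s => \int[mu]_(x in `[a, b]) f s x : R^o)
    \o shift t) (h *: (1 : R^o)) - \int[mu]_(x in `[a, b]) f t x)) =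
   (fun h => h^-1 *: ((\int[mu]_(x in `[a, b]) f (h + t) x) -
    \int[mu]_(x in `[a, b]) f t x)).
  by apply/funext => h; rewrite /= [h *: _]mulr1.
rewrite (_ : \int[mu]_(x in `[a, b]) ft t x =
  \int[mu]_(x in `[a, b]) partial1of2 f t x).
  apply: DeriveDef.
    by apply/cvg_ex; exists (\int[mu]_(x in `[a, b]) partial1of2 f t x); rewrite E.
  by rewrite /derive E; exact: (cvg_lim (@norm_hausdorff _ _) H).
by apply: eq_Rintegral => x xab; rewrite pE//; rewrite inE in xab.
Qed.

End parameter.

(* Differentiating f(t,x) - f(t,a) = \int_a^x f_x(t,y) dy in t, then in x. *)
Lemma has_dw_mixed (R : realType) (c d a b : R) (f ft fx fxt : R -> R -> R^o)
    (t : R) : a < b ->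
  (forall s x, s \in `[c, d] -> x \in `[a, b] ->
     has_dw c d (f ^~ x) s (ft s x)) ->
  (forall s x, s \in `[c, d] -> x \in `[a, b] ->
     has_dw a b (f s) x (fx s x)) ->
  (forall s x, s \in `[c, d] -> x \in `[a, b] ->
     has_dw c d (fx ^~ x) s (fxt s x)) ->
  (forall s, s \in `[c, d] -> {within `[a, b], continuous (fx s)}) ->
  {within `[c, d] `*` `[a, b], continuous (fun p : R * R => fxt p.1 p.2)} ->
  t \in `]c, d[ ->
  forall x, x \in `[a, b] -> has_dw a b (ft t) x (fxt t x).
Proof.
move=> hab ftE fxE fxtE cfx cfxt tcd; have tcd' := subset_itv_oo_cc tcd.
have hcd : c < d by apply: lt_trans (_ : c < t) (_ : t < d); rewrite (itvP tcd).
have [H HE] := antiderivative hab (within_rectangle_slice tcd' cfxt).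
(* Here [H] is a primitive of [fxt t], so this formula can be differentiated in [x] at once. *)
suff E x : x \in `[a, b] -> ft t x = ft t a + (H x - H a).
  move=> x xab; apply: (@has_dw_eq R a b R^o (fun x => (ft t a - H a) + H x)) => //.
    by move=> y yab; rewrite (E y)//= -addrA (addrC (- _)).
  by rewrite -[fxt t x]add0r; apply: has_dwD; [exact: has_dw_cst|exact: HE].
move=> xab; have [->|xa] := eqVneq x a; first by rewrite subrr addr0.
have ax : a < x by rewrite lt_neqAle eq_sym xa (itvP xab).
have sub : `[a, x] `<=` `[a, b] by apply: subset_itvl; rewrite bnd_simp (itvP xab).
have subX : `[c, d] `*` `[a, x] `<=` `[c, d] `*` `[a, b].
  by move=> [u v] [/= ucd vax]; split => //=; exact: sub vax.
have aab : a \in `[a, b] by rewrite in_itv /= lexx ltW.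
have D1 : is_derive (t : R^o) (1 : R^o)
    (fun s => \int[@lebesgue_measure R]_(y in `[a, x]) fx s y : R^o) (H x - H a).
  rewrite -(@Rintegral_FTC2 R a x ax (fxt t) H).
  - apply: (@is_derive_Rintegral R c d a x) => //.
    + by move=> s y scd yax; apply: fxtE => //; exact: sub.
    + by move=> s scd; exact: continuous_subspaceW sub (cfx _ scd).
    + exact: continuous_subspaceW subX cfxt.
  - exact: continuous_subspaceW sub (within_rectangle_slice tcd' cfxt).
  - by move=> y yax; apply: (has_dw_subitv sub); apply: HE; exact: sub.
(* [D2] and [D3] compute the same t-derivative, from [ft] and under the integral sign; uniqueness
   equates them. *)
have D2 : has_dw c d (fun s => f s x - f s a : R^o) t (ft t x - ft t a).
  by apply: has_dwB; exact: ftE.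
have D3 : has_dw c d (fun s => f s x - f s a : R^o) t (H x - H a).
  apply: has_dw_eq (is_derive_has_dw c d D1) => // s scd /=.
  apply: Rintegral_FTC2 => //.
    exact: continuous_subspaceW sub (cfx _ scd).
  by move=> y yax; apply: (has_dw_subitv sub); apply: fxE => //; exact: sub.
by rewrite -(has_dw_uniq hcd tcd' D2 D3) addrC subrK.
Qed.

(** * Smooth functions *)

Section dot.
Context (R : realType) (n : nat).
Implicit Types (u v w : 'rV[R]_n) (k : R).

Lemma dotC u v : dot u v = dot v u.
Proof. by apply: eq_bigr => i _; rewrite mulrC. Qed.

Lemma dotDl u v w : dot (u + v) w = dot u w + dot v w.
Proof. by rewrite -big_split; apply: eq_bigr => i _; rewrite mxE mulrDl. Qed.

Lemma dotZl k u w : dot (k *: u) w = k * dot u w.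
Proof. by rewrite mulr_sumr; apply: eq_bigr => i _; rewrite mxE mulrA. Qed.

Lemma dotDr u v w : dot w (u + v) = dot w u + dot w v.
Proof. by rewrite dotC dotDl !(dotC w). Qed.

Lemma dotZr k u w : dot w (k *: u) = k * dot w u.
Proof. by rewrite dotC dotZl (dotC w). Qed.

Lemma dotNl u w : dot (- u) w = - dot u w.
Proof. by rewrite -scaleN1r dotZl mulN1r. Qed.

Lemma dotNr u w : dot w (- u) = - dot w u.
Proof. by rewrite dotC dotNl (dotC w). Qed.

Lemma dot0l w : dot 0 w = 0.
Proof. by rewrite -(scale0r w) dotZl mul0r. Qed.

Lemma dot0r w : dot w 0 = 0.
Proof. by rewrite dotC dot0l. Qed.

Lemma dot_delta i v : dot (delta_mx 0 i) v = v 0 i.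
Proof.
rewrite /dot (bigD1 i)//= [X in _ + X]big1 ?addr0.
  by rewrite mxE !eqxx mul1r.
by move=> j ji; rewrite mxE (negbTE ji) andbF mul0r.
Qed.

Lemma dot_ge0 u : 0 <= dot u u.
Proof. by apply: sumr_ge0 => i _; rewrite -expr2 sqr_ge0. Qed.

Lemma dot_eq0 u : (dot u u == 0) = (u == 0).
Proof.
apply/eqP/eqP => [u0|->]; last exact: dot0l.
have sq0 i : true -> 0 <= u 0 i * u 0 i by rewrite -expr2 sqr_ge0.
apply/rowP => i; apply/eqP; rewrite mxE -sqrf_eq0 expr2; apply/eqP.
by have /(_ i erefl) := psumr_eq0P sq0 u0.
Qed.

Lemma dot_gt0 u : u != 0 -> 0 < dot u u.
Proof. by move=> u0; rewrite lt_neqAle eq_sym dot_eq0 u0 dot_ge0. Qed.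

End dot.

Section coordinates.
Context (R : realType) (a b : R) (n : nat).
Implicit Types (f g : R -> 'rV[R]_n) (l m : 'rV[R]_n).

Lemma has_dw_coord f x l i : has_dw a b f x l ->
  has_dw a b (fun y => f y 0 i : R^o) x (l 0 i).
Proof.
move=> fl; rewrite /has_dw (_ : (fun y => _) = (fun M : 'rV[R]_n => M 0 i) \o
    (fun y => (y - x)^-1 *: (f y - f x))).
  exact: (cvg_comp _ _ fl (@coord_continuous R 1 n 0 i l)).
by apply/funext => y; rewrite /= !mxE.
Qed.

Lemma has_dw_rV f x l : (forall i, has_dw a b (fun y => f y 0 i : R^o) x (l 0 i)) ->
  has_dw a b f x l.
Proof.
move=> fl; rewrite (row_sum_delta l).
have -> : f = fun y => \sum_j f y 0 j *: delta_mx 0 j.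
  by apply/funext => y; exact: row_sum_delta.
apply: has_dw_sum => i.
rewrite -[X in has_dw _ _ _ _ X]addr0 -(scaler0 _ (f x 0 i)).
by apply: has_dwZ; [exact: fl|exact: has_dw_cst].
Qed.

Lemma has_dw_dot f g x l m : has_dw a b f x l -> has_dw a b g x m ->
  has_dw a b (fun y => dot (f y) (g y) : R^o) x (dot l (g x) + dot (f x) m : R^o).
Proof.
move=> fl gm; rewrite /dot -big_split; apply: has_dw_sum => i.
by apply: has_dwM; exact: has_dw_coord.
Qed.

End coordinates.

Section smooth_theory.
Context (R : realType) (a b : R).
Hypothesis hab : a < b.

(** Peels off one derivative at a time, so that closure under products can be proved by induction
    with the functions generalized. It is enough to count derivability: continuity follows from
    it. *)
Fixpoint Ck (V : normedModType R) (k : nat) (f : R -> V) : Prop :=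
  if k is k'.+1 then
    (forall x, x \in `[a, b] -> derivable_within a b f x) /\
    Ck k' (derive_within a b f)
  else True.

Section general.
Variable V : normedModType R.
Implicit Types f g : R -> V.

Lemma smoothP f : smooth a b f <-> forall k, Ck k f.
Proof.
split=> [sf k|].
  suff H : forall j, Ck k (nderive_within a b j f) by exact: (H 0%N).
  by elim: k => //= k ih j; split => [x|]; [exact: sf|exact: (ih j.+1)].
move=> Cf k x xab; have : Ck k.+1 f by [].
elim: k f {Cf} => [|k ih] f [df Cf]; first exact: df.
by rewrite /nderive_within iterSr; exact: ih.
Qed.

Lemma smooth_has_dw f x : smooth a b f -> x \in `[a, b] ->
  has_dw a b f x (derive_within a b f x).
Proof. by move=> sf xab; exact: (sf 0%N). Qed.

Lemma smooth_derive f : smooth a b f -> smooth a b (derive_within a b f).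
Proof. by move=> /smoothP sf; apply/smoothP => k; have [] := sf k.+1. Qed.

Lemma smooth_continuous f : smooth a b f -> {within `[a, b], continuous f}.
Proof. by move=> sf; apply: has_dw_continuous => x; exact: smooth_has_dw. Qed.

Lemma Ck_eq k f g : {in `[a, b], f =1 g} -> Ck k f -> Ck k g.
Proof.
elim: k f g => //= k ih f g fg [df Cf]; split.
  by move=> x xab; apply/cvg_ex; exists (derive_within a b f x);
    apply: has_dw_eq fg _ => //; exact: df.
by apply: ih Cf => x xab; exact: eq_derive_within.
Qed.

Lemma Ck_has_dw k f g :
  (forall x, x \in `[a, b] -> has_dw a b f x (g x)) -> Ck k g -> Ck k.+1 f.
Proof.
move=> fg Cg; split => [x xab|]; first by have [] := has_dwP hab xab (fg x xab).
by apply: Ck_eq Cg => x xab; rewrite (has_dwE hab xab (fg x xab)).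
Qed.

Lemma Ck_S k f : Ck k.+1 f -> Ck k f.
Proof. by elim: k f => // k ih f [df Cf]; split => //; exact: ih. Qed.

Lemma Ck_cst k (v : V) : Ck k (fun=> v).
Proof.
elim: k v => // k ih v; apply: (@Ck_has_dw _ _ (fun=> 0)) => // x _.
exact: has_dw_cst.
Qed.

Lemma CkD k f g : Ck k f -> Ck k g -> Ck k (fun x => f x + g x).
Proof.
elim: k f g => // k ih f g [df Cf] [dg Cg]; apply: Ck_has_dw; last exact: ih Cf Cg.
by move=> x xab; apply: has_dwD; [exact: df|exact: dg].
Qed.

Lemma smooth_eq f g : {in `[a, b], f =1 g} -> smooth a b f -> smooth a b g.
Proof. by move=> fg /smoothP sf; apply/smoothP => k; exact: Ck_eq fg (sf k). Qed.

Lemma has_dw_smooth f g : (forall x, x \in `[a, b] -> has_dw a b f x (g x)) ->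
  smooth a b g -> smooth a b f.
Proof.
move=> fg /smoothP sg; apply/smoothP => -[|k]//; exact: Ck_has_dw fg (sg k).
Qed.

Lemma smooth_cst (v : V) : smooth a b (fun=> v).
Proof. by apply/smoothP => k; exact: Ck_cst. Qed.

Lemma smoothD f g : smooth a b f -> smooth a b g -> smooth a b (fun x => f x + g x).
Proof. by move=> /smoothP sf /smoothP sg; apply/smoothP => k; exact: CkD. Qed.

Lemma smooth_sum (I : Type) (r : seq I) (F : I -> R -> V) :
  (forall i, smooth a b (F i)) -> smooth a b (fun x => \sum_(i <- r) F i x).
Proof.
move=> sF; elim: r => [|i r ih].
  by apply: (smooth_eq _ (@smooth_cst 0)) => x _; rewrite big_nil.
by apply: (smooth_eq _ (smoothD (sF i) ih)) => x _; rewrite big_cons.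
Qed.

End general.

Lemma CkZ (V : normedModType R) k (h : R -> R^o) (f : R -> V) :
  Ck k h -> Ck k f -> Ck k (fun x => h x *: f x).
Proof.
elim: k h f => // k ih h f Ch Cf.
have [dh Ch'] := Ch; have [df Cf'] := Cf.
apply: (@Ck_has_dw _ _ _
  (fun x => derive_within a b h x *: f x + h x *: derive_within a b f x)).
  by move=> x xab; apply: has_dwZ; [exact: dh|exact: df].
by apply: CkD; apply: ih => //; exact: Ck_S.
Qed.

Lemma smoothZ (V : normedModType R) (h : R -> R^o) (f : R -> V) :
  smooth a b h -> smooth a b f -> smooth a b (fun x => h x *: f x).
Proof. by move=> /smoothP sh /smoothP sf; apply/smoothP => k; exact: CkZ. Qed.

Lemma smoothM (h f : R -> R^o) : smooth a b h -> smooth a b f ->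
  smooth a b (fun x => h x * f x : R^o).
Proof. exact: smoothZ. Qed.

Lemma smoothZr (V : normedModType R) (k : R) (f : R -> V) :
  smooth a b f -> smooth a b (fun x => k *: f x).
Proof. by move=> sf; apply: smoothZ => //; exact: (@smooth_cst R^o). Qed.

Lemma smoothB (V : normedModType R) (f g : R -> V) :
  smooth a b f -> smooth a b g -> smooth a b (fun x => f x - g x).
Proof.
move=> sf sg; apply: smoothD => //.
by apply: (smooth_eq _ (@smoothZr _ (-1) _ sg)) => x _; rewrite scaleN1r.
Qed.

Lemma smooth_coord n (f : R -> 'rV[R]_n) i : smooth a b f ->
  smooth a b (fun x => f x 0 i : R^o).
Proof.
move=> /smoothP sf; apply/smoothP => k; have {sf} := sf k.
elim: k f => // k ih f [df Cf].
apply: (@Ck_has_dw _ _ _ (fun x => derive_within a b f x 0 i)); last exact: ih.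
by move=> x xab; apply: has_dw_coord; exact: df.
Qed.

Lemma smooth_dot n (f g : R -> 'rV[R]_n) : smooth a b f -> smooth a b g ->
  smooth a b (fun x => dot (f x) (g x) : R^o).
Proof.
by move=> sf sg; apply: smooth_sum => i; apply: smoothM; exact: smooth_coord.
Qed.

Lemma antiderivative_rV n (f : R -> 'rV[R]_n) : {within `[a, b], continuous f} ->
  exists F : R -> 'rV[R]_n, forall x, x \in `[a, b] -> has_dw a b F x (f x).
Proof.
move=> cf.
have cfi i : {within `[a, b], continuous (fun x => f x 0 i : R^o)}.
  by move=> x; exact: (cvg_comp _ _ (cf x) (@coord_continuous R 1 n 0 i (f x))).
have [F HF] := choice (fun i => antiderivative hab (cfi i)).
exists (fun x => \row_i F i x) => x xab; apply: has_dw_rV => i.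
rewrite (_ : (fun y => _) = F i); first exact: HF.
by apply/funext => y; rewrite mxE.
Qed.

Lemma has_dw0_cst_rV n (f : R -> 'rV[R]_n) :
  (forall x, x \in `[a, b] -> has_dw a b f x 0) ->
  forall x, x \in `[a, b] -> f x = f a.
Proof.
move=> f0 x xab; apply/rowP => i.
have fi0 y : y \in `[a, b] -> has_dw a b (fun x => f x 0 i : R^o) y (0 : R^o).
  by move=> /f0 fy; have := @has_dw_coord _ _ _ _ _ _ _ i fy; rewrite mxE.
apply: (@has_dw0_cst R a b (fun x => f x 0 i) (has_dw_continuous fi0)) => // y yab.
by apply: fi0; exact: subset_itv_oo_cc.
Qed.

End smooth_theory.

(** * Bump functions *)

Section bump.
Context (R : realType).

(* The functions x^-k e^(-1/x) for 0 < x, extended by 0, are stable under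
   differentiation up to linear combinations. *)
Definition flat (k : nat) (x : R) : R :=
  if 0 < x then x^-1 ^+ k * expR (- x^-1) else 0.

(** With u = 1/x, the exponential satisfies e^u >= u^(k+1) / (k+1)!; the power of u beyond k leaves
    the factor x, which forces decay at 0. *)
Lemma flat_le k (x : R) : `|flat k x| <= k.+1`!%:R * `|x|.
Proof.
rewrite /flat; case: ifPn => [x0|_]; last by rewrite normr0 mulr_ge0.
have u0 : 0 < x^-1 by rewrite invr_gt0.
rewrite !gtr0_norm ?mulr_gt0 ?exprn_gt0 ?expR_gt0//.
rewrite expRN -[X in _ <= _ * X]invrK ler_pdivrMr ?expR_gt0//.
rewrite mulrAC ler_pdivlMr// -exprSr.
have := expR_ge1Dxn k (ltW u0).
rewrite -ler_pdivrMl ?ltr0n ?fact_gt0// mulrC; apply: le_trans.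
by rewrite lerDr.
Qed.

Lemma flat_gt0 k (x : R) : 0 < x -> 0 < flat k x.
Proof. by move=> x0; rewrite /flat x0 mulr_gt0 ?expR_gt0// exprn_gt0 ?invr_gt0. Qed.

Lemma flat_eq0 k (x : R) : x <= 0 -> flat k x = 0.
Proof. by rewrite leNgt /flat => /negbTE ->. Qed.

Lemma is_derive_flat k (x : R) :
  is_derive (x : R^o) (1 : R^o) (flat k : R^o -> R^o)
    (flat k.+2 x - k%:R * flat k.+1 x).
Proof.
have [x0|x0|->] := ltgtP x 0.
- rewrite !flat_eq0 ?(ltW x0)// mulr0 subrr.
  apply: (@near_eq_is_derive _ _ _ (fun=> 0 : R^o)).
  near=> y; rewrite flat_eq0//; apply/ltW; near: y.
  exact: lt_nbhsl.
- apply: (@near_eq_is_derive _ _ _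
      (((fun y : R => y^-1) ^+ k) * (expR \o (- (fun y : R => y^-1))))).
    near=> y; rewrite /flat ifT; last by near: y; exact: lt_nbhsr.
    by rewrite /GRing.mul /= exprfctE.
  have xn0 : x != 0 by rewrite gt_eqF.
  have H := @is_deriveV R id x 1 1 xn0 (is_derive_id x 1).
  apply: (is_derive_eq (is_deriveM (is_deriveX k H)
    (is_derive1_comp (is_derive_expR _) (is_deriveN H)))).
  rewrite /flat x0 /= exprfctE !opprfctE /GRing.scale /= -exprVn.
  rewrite !mulr1; set u := x^-1; set e := expR (- u).
  (* With u = 1/x one has u' = -u^2, so each differentiation raises the power of u by one or two. *)
  have E (v w : R) : v ^+ k * (w * - - v ^+ 2) + w * (k%:R * v ^+ k.-1 * - v ^+ 2)
      = v ^+ k.+2 * w - k%:R * (v ^+ k.+1 * w).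
    by case: (k) => [|m] /=; rewrite !exprS expr0; ring.
  exact: E.
- rewrite !flat_eq0// mulr0 subrr; apply: (@has_dw_interior R (-1) 1).
    by rewrite in_itv /=; apply/andP; split; lra.
  rewrite /has_dw (_ : (fun y => _) = flat k.+1); last first.
    apply/funext => y; rewrite subr0 [flat k 0]flat_eq0// subr0 /flat.
    by case: ifP => _; rewrite ?scaler0// exprS -mulrA.
  apply/cvgr0Pnorm_lt => e e0; near=> y.
  apply: le_lt_trans (flat_le _ _) _.
  rewrite mulrC -ltr_pdivlMr ?ltr0n ?fact_gt0//.
  near: y; exists (e / k.+2`!%:R) => /=.
    by rewrite divr_gt0// ltr0n fact_gt0.
  by move=> y /=; rewrite sub0r normrN.
Unshelve. all: by end_near. Qed.

(** The derivative combines [flat k.+2] and [flat k.+1], so the induction on the order keeps [k]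
    general. *)
Lemma smooth_flat_affine (a b : R) k (s t : R) : a < b ->
  smooth a b (fun x => flat k (s * x + t) : R^o).
Proof.
move=> hab; apply/smoothP => m; elim: m k => // m ih k.
pose dflat x := s * (flat k.+2 (s * x + t) - k%:R * flat k.+1 (s * x + t)).
apply: (@Ck_has_dw R a b hab R^o m _ dflat).
  move=> x _; apply: is_derive_has_dw; rewrite /dflat mulrC.
  apply: (@is_derive1_comp _ (flat k) (fun x => s * x + t)).
    exact: is_derive_flat.
  apply: (@has_dw_interior R (x - 1) (x + 1)).
    by rewrite in_itv /=; apply/andP; split; lra.
  rewrite -[s in has_dw _ _ _ _ s]mulr1 -[X in has_dw _ _ _ _ X]addr0.
  by apply: (@has_dwD _ _ _ R^o); [apply: has_dwMr; exact: has_dw_id|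
    exact: (@has_dw_cst _ _ _ R^o)].
apply: (@CkZ R a b hab R^o m (fun=> s)); first exact: Ck_cst.
apply: CkD => //; apply: (@Ck_eq R a b R^o m
  (fun x => - k%:R *: flat k.+1 (s * x + t) : R^o)).
  by move=> x _; rewrite /= scaleNr.
by apply: (@CkZ R a b hab R^o m (fun=> - k%:R)) => //; exact: Ck_cst.
Qed.

Lemma bump_exists (a b c d : R) : a < b -> exists phi : R -> R^o,
  [/\ smooth a b phi, forall x, c < x < d -> 0 < phi x &
      forall x, x <= c \/ d <= x -> phi x = 0].
Proof.
move=> hab; exists (fun x => flat 0 (1 * x + - c) * flat 0 (-1 * x + d)); split.
- by apply: smoothM => //; exact: smooth_flat_affine.
- by move=> x /andP[cx xd]; rewrite mulr_gt0// flat_gt0//; lra.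
- move=> x [xc|dx]; first by rewrite flat_eq0 ?mul0r//; lra.
  by rewrite [X in _ * X]flat_eq0 ?mulr0//; lra.
Qed.

End bump.

(** * First variation of the bending energy *)

Lemma cvg_dot (R : realType) (n : nat) (T : Type) (F : set_system T)
    (f g : T -> 'rV[R]_n) (u v : 'rV[R]_n) : Filter F ->
  f @ F --> u -> g @ F --> v -> (fun t => dot (f t) (g t)) @ F --> dot u v.
Proof.
move=> FF fu gv; rewrite /dot; apply: (@cvg_big R^o).
  exact: (@add_continuous R^o).
move=> i _; apply: cvgM.
  exact: (cvg_comp _ _ fu (@coord_continuous R 1 n 0 i u)).
exact: (cvg_comp _ _ gv (@coord_continuous R 1 n 0 i v)).
Qed.

Section energy_density.
Context (R : realType).

(* [v] and [w] are the velocity and the acceleration of a curve, [v'] and [w']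
   their derivatives along a variation. *)
Definition bending_density (n : nat) (v w : 'rV[R]_n) : R :=
  (dot w w * dot v v - dot v w ^+ 2) * (Num.sqrt (dot v v))^-1 ^+ 5.

(** Left in the unsimplified shape that the product, power, inverse and root rules deliver, which
    explains factors such as [^+ 1]. *)
Definition bending_density' (n : nat) (v w v' w' : 'rV[R]_n) : R :=
  let p := dot v v in let s := Num.sqrt p in
  let p' := dot v' v + dot v v' in
  ((dot w' w + dot w w') * p + dot w w * p'
    - 2%:R * dot v w ^+ 1 * (dot v' w + dot v w')) * s^-1 ^+ 5
  + (dot w w * p - dot v w ^+ 2) * (5%:R * s^-1 ^+ 4 * (- (p' / (2 * s) / s ^+ 2))).

Lemma has_dw_bending_density (c d : R) (n : nat) (v w : R -> 'rV[R]_n) (t : R)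
    (v' w' : 'rV[R]_n) : v t != 0 -> has_dw c d v t v' -> has_dw c d w t w' ->
  has_dw c d (fun s => bending_density (v s) (w s) : R^o) t
    (bending_density' (v t) (w t) v' w').
Proof.
move=> vt0 dv dw; have p0 := dot_gt0 vt0.
have s0 : Num.sqrt (dot (v t) (v t)) != 0 by rewrite gt_eqF// sqrtr_gt0.
apply: has_dwM.
  apply: has_dwB; first by apply: has_dwM; exact: has_dw_dot.
  by apply: (@has_dwX _ _ _ _ 2); exact: has_dw_dot.
apply: (@has_dwX _ _ _ _ 5); apply: has_dwV => //.
by apply: has_dw_sqrt => //; exact: has_dw_dot.
Qed.

(** Trading the normalized tangent for velocity and acceleration leaves only the first two
    x-derivatives of the family to be differentiated in t. *)
Lemma bending_densityE (a b : R) (n : nat) (gamma : R -> 'rV[R]_n) (x : R) :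
  let D := @derive_within R 'rV[R]_n a b in
  a < b -> x \in `[a, b] -> D gamma x != 0 ->
  derivable_within a b (D gamma) x ->
  let kappa := arc_derive a b gamma (unit_tangent a b gamma) x in
  dot kappa kappa * enorm (D gamma x) =
  bending_density (D gamma x) (D (D gamma) x).
Proof.
move=> D hab xab v0 dv kappa.
set v := D gamma x; set w := D (D gamma) x.
have dvw : has_dw a b (D gamma) x w by [].
have p0 : 0 < dot v v := dot_gt0 v0.
have s0 : Num.sqrt (dot v v) != 0 by rewrite gt_eqF// sqrtr_gt0.
have H : has_dw a b (unit_tangent a b gamma) x
    ((- ((dot w v + dot v w) / (2 * Num.sqrt (dot v v)) / Num.sqrt (dot v v) ^+ 2))
      *: v + (Num.sqrt (dot v v))^-1 *: w).
  apply: (@has_dwZ _ _ _ _ (fun y => (Num.sqrt (dot (D gamma y) (D gamma y)))^-1)) => //.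
  apply: (@has_dwV _ _ _ (fun y => Num.sqrt (dot (D gamma y) (D gamma y)))) => //.
  apply: (@has_dw_sqrt _ _ _ (fun y => dot (D gamma y) (D gamma y))) => //.
  exact: has_dw_dot.
rewrite /kappa /arc_derive (has_dwE hab xab H) /enorm -/D -/v /bending_density.
(* All that matters about the root is s <> 0 and s^2 = <v, v>; with s a free symbol the claim is a
   rational identity. *)
have E (s : R) : s != 0 -> s ^+ 2 = dot v v ->
    let k := s^-1 *: (- ((dot w v + dot v w) / (2 * s) / s ^+ 2) *: v + s^-1 *: w) in
    dot k k * s = (dot w w * dot v v - dot v w ^+ 2) * s^-1 ^+ 5.
  clear; move: v w => v w s0 sE /=.
  rewrite !(dotZl, dotZr, dotDl, dotDr) (dotC w v) -sE.
  by move: (dot v w) (dot w w) => q r; field.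
by apply: E => //; rewrite sqr_sqrtr// ltW.
Qed.

End energy_density.

(** Stated for an arbitrary filter so as to give joint continuity in (t, x), which differentiation
    under the integral sign requires. *)
Lemma cvg_bending_density' (R : realType) (n : nat) (T : Type)
    (F : set_system T) (v w v' w' : T -> 'rV[R]_n) (v0 w0 v0' w0' : 'rV[R]_n) :
  Filter F -> v0 != 0 ->
  v @ F --> v0 -> w @ F --> w0 -> v' @ F --> v0' -> w' @ F --> w0' ->
  (fun t => bending_density' (v t) (w t) (v' t) (w' t)) @ F -->
  bending_density' v0 w0 v0' w0'.
Proof.
move=> FF vn0 cv cw cv' cw'.
have s0 : Num.sqrt (dot v0 v0) != 0 by rewrite gt_eqF// sqrtr_gt0 dot_gt0.
have cs : (fun t => Num.sqrt (dot (v t) (v t))) @ F --> Num.sqrt (dot v0 v0).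
  by apply: (cvg_comp _ _ (cvg_dot FF cv cv)); exact: sqrt_continuous.
have cX (f : T -> R) (l : R) k : f @ F --> l -> (fun t => f t ^+ k) @ F --> l ^+ k.
  by move=> fl; exact: (cvg_comp _ _ fl (@exprn_continuous R k l)).
have csV : (fun t => (Num.sqrt (dot (v t) (v t)))^-1) @ F --> (Num.sqrt (dot v0 v0))^-1.
  exact: cvgV.
have cK (k : R) : (fun=> k) @ F --> k by exact: cvg_cst.
have s20 : 2 * Num.sqrt (dot v0 v0) != 0 by rewrite mulf_neq0.
have s30 : Num.sqrt (dot v0 v0) ^+ 2 != 0 by rewrite expf_neq0.
rewrite /bending_density'.
apply: cvgD.
  apply: cvgM; last exact: cX.
  apply: cvgB; last first.
    apply: cvgM; last by apply: cvgD; exact: cvg_dot.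
    by apply: cvgM => //; apply: cX; exact: cvg_dot.
  by apply: cvgD; apply: cvgM; do ?apply: cvgD; exact: cvg_dot.
apply: cvgM.
  by apply: cvgB; [apply: cvgM; exact: cvg_dot|apply: cX; exact: cvg_dot].
apply: cvgM; first by apply: cvgM => //; exact: cX.
apply: cvgN; apply: cvgM; last by apply: cvgV => //; exact: cX.
apply: cvgM; first by apply: cvgD; exact: cvg_dot.
by apply: cvgV => //; exact: cvgM.
Qed.

Lemma cvg_bending_density (R : realType) (n : nat) (T : Type)
    (F : set_system T) (v w : T -> 'rV[R]_n) (v0 w0 : 'rV[R]_n) :
  Filter F -> v0 != 0 -> v @ F --> v0 -> w @ F --> w0 ->
  (fun t => bending_density (v t) (w t)) @ F --> bending_density v0 w0.
Proof.
move=> FF vn0 cv cw.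
have s0 : Num.sqrt (dot v0 v0) != 0 by rewrite gt_eqF// sqrtr_gt0 dot_gt0.
have cs : (fun t => Num.sqrt (dot (v t) (v t))) @ F --> Num.sqrt (dot v0 v0).
  by apply: (cvg_comp _ _ (cvg_dot FF cv cv)); exact: sqrt_continuous.
have cX (f : T -> R) (l : R) k : f @ F --> l -> (fun t => f t ^+ k) @ F --> l ^+ k.
  by move=> fl; exact: (cvg_comp _ _ fl (@exprn_continuous R k l)).
apply: cvgM; last by apply: cX; exact: cvgV.
by apply: cvgB; [apply: cvgM; exact: cvg_dot|apply: cX; exact: cvg_dot].
Qed.

Lemma within_rectangle_snd (R : realType) (V : topologicalType) (c d a b : R)
    (f : R -> V) : {within `[a, b], continuous f} ->
  {within `[c, d] `*` `[a, b], continuous (fun p : R * R => f p.2)}.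
Proof.
move=> /subspace_continuousP cf; apply/subspace_continuousP.
move=> -[s x] /= [scd xab] P /(cf x xab) H.
exists (setT, [set y | `[a, b]%classic y -> P (f y)]) => /=.
  by split; [exact: filterT|exact: H].
by move=> [s' y] /= [_ Hy] [_ yab]; exact: Hy.
Qed.

(** The change of |v|^2 is 2 <v', v> = 0, and the change of <v, w> enters only multiplied by <v, w>
    = 0; just the change of |w|^2 survives. *)
Lemma bending_density'_unit (R : realType) (n : nat) (v w v' w' : 'rV[R]_n) :
  dot v v = 1 -> dot v w = 0 -> dot v' v = 0 ->
  bending_density' v w v' w' = 2 * dot w w'.
Proof.
move=> vv vw v'v; rewrite /bending_density' vv vw (dotC v v') v'v sqrtr1 invr1.
by rewrite (dotC w' w); ring.
Qed.

Lemma is_derive_Rintegral_density (R : realType) (n : nat) (c d a b : R)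
    (rho : R -> R^o) (v w v' w' : R -> R -> 'rV[R]_n) (t : R) :
  {within `[a, b], continuous rho} ->
  (forall s x, s \in `[c, d] -> x \in `[a, b] -> has_dw c d (v ^~ x) s (v' s x)) ->
  (forall s x, s \in `[c, d] -> x \in `[a, b] -> has_dw c d (w ^~ x) s (w' s x)) ->
  (forall s x, s \in `[c, d] -> x \in `[a, b] -> v s x != 0) ->
  {within `[c, d] `*` `[a, b], continuous (fun p : R * R => v p.1 p.2)} ->
  {within `[c, d] `*` `[a, b], continuous (fun p : R * R => w p.1 p.2)} ->
  {within `[c, d] `*` `[a, b], continuous (fun p : R * R => v' p.1 p.2)} ->
  {within `[c, d] `*` `[a, b], continuous (fun p : R * R => w' p.1 p.2)} ->
  t \in `]c, d[ ->
  is_derive (t : R^o) (1 : R^o)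
    (fun s => \int[@lebesgue_measure R]_(x in `[a, b])
      (rho x * bending_density (v s x) (w s x)) : R^o)
    (\int[@lebesgue_measure R]_(x in `[a, b])
      (rho x * bending_density' (v t x) (w t x) (v' t x) (w' t x)) : R^o).
Proof.
move=> crho dv dw v_n0 cv cw cv' cw' tcd.
apply: (@is_derive_Rintegral R c d a b
  (fun s x => rho x * bending_density (v s x) (w s x))
  (fun s x => rho x * bending_density' (v s x) (w s x) (v' s x) (w' s x)) t _ _ _ tcd).
- move=> s x scd xab; apply: (@has_dwMr _ _ _ (rho x)).
  exact: (has_dw_bending_density (v_n0 s x scd xab) (dv s x scd xab) (dw s x scd xab)).
- move=> s scd; apply/subspace_continuousP => x xab.
  move/subspace_continuousP : crho => crho.
  have /subspace_continuousP cvs := within_rectangle_slice scd cv.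
  have /subspace_continuousP cws := within_rectangle_slice scd cw.
  apply: cvgM; first exact: crho.
  apply: cvg_bending_density; [exact: v_n0|exact: cvs|exact: cws].
- have {}crho := within_rectangle_snd (c := c) (d := d) crho.
  move/subspace_continuousP : crho => crho.
  move/subspace_continuousP : cv => cv; move/subspace_continuousP : cw => cw.
  move/subspace_continuousP : cv' => cv'; move/subspace_continuousP : cw' => cw'.
  apply/subspace_continuousP => p pK; have [p1 p2] := pK.
  apply: cvgM; first exact: crho.
  apply: cvg_bending_density'; first exact: v_n0.
  + exact: cv.
  + exact: cw.
  + exact: cv'.
  + exact: cw'.
Qed.

Section first_variation_formula.
Context (R : realType) (n : nat) (a b : R).
Hypothesis hab : a < b.
Notation mu := (@lebesgue_measure R).
Notation D := (@derive_within R 'rV[R]_n a b).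

Lemma arc_length_dotT (gamma : R -> 'rV[R]_n) x :
  arc_length_parametrized a b gamma -> x \in `[a, b] ->
  dot (D gamma x) (D gamma x) = 1.
Proof.
move=> [_ al] /al; rewrite /enorm => E.
by rewrite -(sqr_sqrtr (dot_ge0 _)) E expr1n.
Qed.

Lemma arc_length_dotTT' (gamma : R -> 'rV[R]_n) x :
  arc_length_parametrized a b gamma -> x \in `[a, b] ->
  dot (D gamma x) (D (D gamma) x) = 0.
Proof.
move=> al xab; have [[sg _] _] := al.
have dT : has_dw a b (D gamma) x (D (D gamma) x).
  exact: (smooth_has_dw (smooth_derive sg) xab).
have H1 : has_dw a b (fun y => dot (D gamma y) (D gamma y) : R^o) x (0 : R^o).
  have E : {in `[a, b], (fun=> 1 : R^o) =1 fun y => dot (D gamma y) (D gamma y)}.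
    by move=> y yab /=; rewrite (arc_length_dotT al yab).
  exact: (@has_dw_eq R a b R^o _ _ x 0 xab E (@has_dw_cst R a b R^o 1 x)).
have := has_dw_uniq hab xab (has_dw_dot dT dT) H1.
rewrite (dotC (D (D gamma) x)); lra.
Qed.

Variables (gamma : R -> 'rV[R]_n) (rho : R -> R^o) (eps : R)
  (Gamma : R -> R -> 'rV[R]_n) (W : R -> 'rV[R]_n).
Hypotheses (al : arc_length_parametrized a b gamma) (srho : smooth a b rho)
  (sW : smooth a b W)
  (orth : forall x, x \in `[a, b] -> dot (D W x) (D gamma x) = 0)
  (sv : smooth_variation a b eps gamma Gamma)
  (hW : forall x, x \in `[a, b] -> derive1 (Gamma ^~ x) 0 = W x).

Lemma is_derive_bending_energy :
  is_derive (0 : R^o) (1 : R^o)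
    (fun t => bending_energy a b rho (Gamma t) : R^o)
    (\int[mu]_(x in `[a, b]) (rho x * dot (D (D gamma) x) (D (D W) x)) : R^o).
Proof.
have [eps0 sG cG G0] := sv; have [[sg _] _] := al.
have hcd : - eps < eps by lra.
have t0 : 0 \in `]- eps, eps[ by rewrite in_itv /= oppr_lt0 eps0.
have t0' := subset_itv_oo_cc t0.
pose Dt := @derive_within R 'rV[R]_n (- eps) eps.
pose v t x := D (Gamma t) x; pose w t x := D (v t) x.
pose Gt t x := Dt (Gamma ^~ x) t.
pose vt t x := Dt (v ^~ x) t; pose wt t x := Dt (w ^~ x) t.
(* Order 3 is what [wt] takes: two derivatives in x and one in t. *)
have [_ [dG _ [cv [dv [cvt _] [cw [dw [cwt _] _]]]]]] := sG 3%N.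
have v_n0 t x : t \in `[- eps, eps] -> x \in `[a, b] -> v t x != 0.
  by move=> tcd xab; have [_ +] := cG t tcd; apply.
have v0 x : x \in `[a, b] -> v 0 x = D gamma x.
  by apply: eq_derive_within => y yab; exact: G0.
have w0 x : x \in `[a, b] -> w 0 x = D (D gamma) x.
  by apply: eq_derive_within => y yab; exact: v0.
have Gt0 x : x \in `[a, b] -> Gt 0 x = W x.
  move=> xab; rewrite -hW//; apply/esym.
  have [dGt _] := dG 0 x t0' xab.
  by apply: cvg_lim; [exact: norm_hausdorff|exact: has_dw_dnbhs t0 dGt].
(* Exchange of d/dt and d/dx at time 0, coordinate by coordinate. Applied to [Gamma] it gives
   [vt 0 = D W], and then applied to [v] it gives [wt 0 = D (D W)]. *)
have mixed (f : R -> R -> 'rV[R]_n) :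
    (forall s x, s \in `[- eps, eps] -> x \in `[a, b] ->
      derivable_within (- eps) eps (f ^~ x) s /\ derivable_within a b (f s) x) ->
    (forall s x, s \in `[- eps, eps] -> x \in `[a, b] ->
      derivable_within (- eps) eps (fun t => D (f t) x) s) ->
    (forall s, s \in `[- eps, eps] -> {within `[a, b], continuous (D (f s))}) ->
    {within `[- eps, eps] `*` `[a, b], continuous
      (fun p : R * R => Dt (fun t => D (f t) p.2) p.1)} ->
    forall x, x \in `[a, b] ->
      has_dw a b (fun y => Dt (f ^~ y) 0) x (Dt (fun t => D (f t) x) 0).
  move=> df dfx cfx cfxt x xab; apply: has_dw_rV => i.
  apply: (@has_dw_mixed R (- eps) eps a b (fun t x => f t x 0 i)
    (fun t x => Dt (f ^~ x) t 0 i) (fun t x => D (f t) x 0 i)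
    (fun t x => Dt (fun s => D (f s) x) t 0 i)) => //.
  - by move=> s y scd yab; apply: has_dw_coord; exact: (df s y scd yab).1.
  - by move=> s y scd yab; apply: has_dw_coord; exact: (df s y scd yab).2.
  - by move=> s y scd yab; apply: has_dw_coord; exact: dfx.
  - move=> s scd y.
    exact: (cvg_comp _ _ (cfx s scd y) (@coord_continuous R 1 n 0 i _)).
  - move=> p; exact: (cvg_comp _ _ (cfxt p) (@coord_continuous R 1 n 0 i _)).
have vt0 x : x \in `[a, b] -> vt 0 x = D W x.
  move=> xab.
  have dvt s y (scd : s \in `[- eps, eps]) (yab : y \in `[a, b]) := (dv s y scd yab).1.
  have cvs s (scd : s \in `[- eps, eps]) :=
    @within_rectangle_slice R (- eps) eps a b 'rV[R]_n v s scd cv.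
  have H := mixed Gamma dG dvt cvs cvt x xab.
  exact/esym/(has_dwE hab xab (has_dw_eq xab Gt0 H)).
have wt0 x : x \in `[a, b] -> wt 0 x = D (D W) x.
  move=> xab.
  have dwt s y (scd : s \in `[- eps, eps]) (yab : y \in `[a, b]) := (dw s y scd yab).1.
  have cws s (scd : s \in `[- eps, eps]) :=
    @within_rectangle_slice R (- eps) eps a b 'rV[R]_n w s scd cw.
  have H := mixed v dv dwt cws cwt x xab.
  exact/esym/(has_dwE hab xab (has_dw_eq xab vt0 H)).
pose g t x : R^o := rho x * bending_density (v t x) (w t x).
pose gt t x : R^o := rho x * bending_density' (v t x) (w t x) (vt t x) (wt t x).
have gt0 x : x \in `[a, b] ->
    gt 0 x = 2 * (rho x * dot (D (D gamma) x) (D (D W) x)).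
  move=> xab; rewrite /gt (v0 x xab) (w0 x xab) (vt0 x xab) (wt0 x xab).
  have e1 := arc_length_dotT al xab; have e2 := arc_length_dotTT' al xab.
  by rewrite (bending_density'_unit _ e1 e2 (orth xab)) mulrCA.
have dvt s x (scd : s \in `[- eps, eps]) (xab : x \in `[a, b]) := (dv s x scd xab).1.
have dwt s x (scd : s \in `[- eps, eps]) (xab : x \in `[a, b]) := (dw s x scd xab).1.
have Hder : is_derive (0 : R^o) (1 : R^o)
    (fun t => \int[mu]_(x in `[a, b]) g t x : R^o)
    (\int[mu]_(x in `[a, b]) gt 0 x : R^o).
  exact: (@is_derive_Rintegral_density R n (- eps) eps a b rho v w vt wt 0
    (smooth_continuous srho) dvt dwt v_n0 cv cw cvt cwt t0).
(* The members are known to be curves only for t in [-eps, eps]; agreement near 0 is enough for the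
   derivative. *)
have E : \forall t \near (0 : R^o),
    2^-1 * (\int[mu]_(x in `[a, b]) g t x) = bending_energy a b rho (Gamma t).
  have : \forall t \near (0 : R), t \in `]- eps, eps[ by exact: near_in_itvoo.
  apply: filterS => t /subset_itv_oo_cc tcd; rewrite /bending_energy; congr (_ * _).
  apply: eq_Rintegral => x; rewrite inE /= => xab.
  by rewrite -mulrA (bending_densityE hab xab (v_n0 t x tcd xab) (dv t x tcd xab).2).
apply: (near_eq_is_derive E).
have := has_dw_interior t0
  (@has_dwMr _ _ _ 2^-1 _ _ _ (is_derive_has_dw (- eps) eps Hder)).
congr is_derive.
have -> : \int[mu]_(x in `[a, b]) gt 0 x =
    \int[mu]_(x in `[a, b]) (2 * (rho x * dot (D (D gamma) x) (D (D W) x))).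
  by apply: eq_Rintegral => x; rewrite inE /= => xab; exact: gt0.
(* The 2 from the density cancels the 1/2 in front of the energy. *)
rewrite RintegralZl//; first by rewrite mulrA mulVf ?mul1r// pnatr_eq0.
apply: (within_continuous_integrable (f := fun x => rho x * _)).
have sT' := smooth_derive (smooth_derive sg).
have sW' := smooth_derive (smooth_derive sW).
exact: smooth_continuous (smoothM hab srho (smooth_dot hab sT' sW')).
Qed.

End first_variation_formula.

(** * Admissible variations *)

Section rectangle.
Context (R : realType) (V : normedModType R) (c d a b : R).
Hypotheses (hcd : c < d) (hab : a < b).

(** The partial derivatives of a concrete family are computed only on the rectangle, so regularity
    has to be transported along equality there. *)
Lemma eq_Ck_rectangle k (f g : R -> R -> V) :
  (forall t x, t \in `[c, d] -> x \in `[a, b] -> f t x = g t x) ->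
  Ck_rectangle c d a b k f -> Ck_rectangle c d a b k g.
Proof.
elim: k f g => [|k ih] f g fg /= [cf H].
all: have {}cf : {within `[c, d] `*` `[a, b], continuous (fun p : R * R => g p.1 p.2)}.
1,3: by apply: subspace_eq_continuous cf => -[t x]; rewrite inE /= => -[tcd xab];
       rewrite /from_subspace /= fg.
- by split.
have [df Hx Ht] := H; split; first exact: cf.
split.
- move=> t x tcd xab; have [d1 d2] := df t x tcd xab; split.
    have E : {in `[c, d], f ^~ x =1 g ^~ x} by move=> s scd; exact: fg.
    exact: (has_dwP hcd tcd (has_dw_eq tcd E d1)).1.
  have E : {in `[a, b], f t =1 g t} by move=> s scd; exact: fg.
  exact: (has_dwP hab xab (has_dw_eq xab E d2)).1.
- apply: ih Hx => t x tcd xab.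
  exact: (@eq_derive_within R c d V (f ^~ x) (g ^~ x)
    (fun s scd => fg s x scd xab) t tcd).
- apply: ih Ht => t x tcd xab.
  exact: (@eq_derive_within R a b V (f t) (g t) (fun y yab => fg t y tcd yab) x xab).
Qed.

Lemma within_rectangle_affine (f g : R -> V) :
  {within `[a, b], continuous f} -> {within `[a, b], continuous g} ->
  {within `[c, d] `*` `[a, b], continuous
    (fun p : R * R => f p.2 + p.1 *: g p.2)}.
Proof.
move=> cf cg.
have /subspace_continuousP {}cf := within_rectangle_snd (c := c) (d := d) cf.
have /subspace_continuousP {}cg := within_rectangle_snd (c := c) (d := d) cg.
apply/subspace_continuousP => p pK; apply: cvgD; first exact: cf.
apply: cvgZ; last exact: cg.
by move=> P [e e0 eP]; exists (ball p.1 e, setT) => /=;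
  [split; [exact: nbhsx_ballx|exact: filterT]|move=> q [] /= /eP].
Qed.

(** The class f + t g is stable under both partial derivatives: they are g + t 0 and f' + t g'. *)
Lemma smooth_rectangle_affine (f g : R -> V) : smooth a b f -> smooth a b g ->
  smooth_rectangle c d a b (fun t x => f x + t *: g x).
Proof.
move=> + + k; elim: k f g => [|k ih] f g sf sg.
  by split => //;
    exact: within_rectangle_affine (smooth_continuous sf) (smooth_continuous sg).
have dt t x : has_dw c d (fun t => f x + t *: g x) t (g x).
  have := has_dwD (@has_dw_cst R c d V (f x) t)
    (has_dwZ (@has_dw_id R c d t) (@has_dw_cst R c d V (g x) t)).
  by rewrite add0r scaler0 addr0 scale1r.
have dx t x (xab : x \in `[a, b]) : has_dw a b (fun x => f x + t *: g x) x
    (derive_within a b f x + t *: derive_within a b g x).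
  apply: (@has_dwD R a b V f (fun x => t *: g x)); first exact: (smooth_has_dw sf xab).
  by apply: (@has_dwZr R a b V t g); exact: (smooth_has_dw sg xab).
split; first exact: within_rectangle_affine (smooth_continuous sf) (smooth_continuous sg).
split.
- move=> t x tcd xab; split; first exact: (has_dwP hcd tcd (dt t x)).1.
  exact: (has_dwP hab xab (dx t x xab)).1.
- have := ih g (fun=> 0) sg (@smooth_cst R a b hab V 0).
  apply: eq_Ck_rectangle => t x tcd xab.
  by rewrite scaler0 addr0 (has_dwE hcd tcd (dt t x)).
- have := ih _ _ (smooth_derive sf) (smooth_derive sg).
  apply: eq_Ck_rectangle => t x tcd xab.
  by rewrite (has_dwE hab xab (dx t x xab)).
Qed.

End rectangle.

(** The squared speed at time t is 1 + t^2 |W'|^2, which never vanishes; any [eps] would do, and 1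
    is chosen. *)
Lemma linear_variation (R : realType) (n : nat) (a b : R)
    (gamma W : R -> 'rV[R]_n) : a < b ->
  arc_length_parametrized a b gamma -> smooth a b W ->
  (forall x, x \in `[a, b] ->
    dot (derive_within a b W x) (derive_within a b gamma x) = 0) ->
  smooth_variation a b 1 gamma (fun t x => gamma x + t *: W x).
Proof.
move=> hab al sW orth; have [[sg _] _] := al; split.
- exact: ltr01.
- have h11 : (-1 : R) < 1 by rewrite (lt_trans (ltrN10 _) ltr01).
  exact: (smooth_rectangle_affine h11 hab sg sW).
- move=> t _; split; first exact: (smoothD hab sg (@smoothZr R a b hab _ t _ sW)).
  move=> x xab.
  rewrite (has_dwE hab xab (@has_dwD R a b _ gamma (fun x => t *: W x) x _ _
    (smooth_has_dw sg xab) (has_dwZr (k := t) (smooth_has_dw sW xab)))).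
  have := arc_length_dotT al xab; have := orth x xab.
  move: (derive_within a b W x) (derive_within a b gamma x) => Y T YT TT.
  rewrite -dot_eq0 !(dotDl, dotDr, dotZl, dotZr) (dotC T) YT TT gt_eqF//.
  by rewrite !mulr0 addr0 add0r mulrA ltr_wpDr// mulr_ge0 ?dot_ge0// -expr2 sqr_ge0.
- by move=> x _; rewrite scale0r addr0.
Qed.

Lemma derive1_linear_variation (R : realType) (V : normedModType R) (u w : V) :
  derive1 (fun t : R => u + t *: w) 0 = w.
Proof.
have t0 : (0 : R) \in `](-1), 1[ by rewrite in_itv /= ltrN10 ltr01.
have := @has_dwD R (-1) 1 V (fun=> u) (fun t => t *: w) 0 0 w
  (@has_dw_cst R (-1) 1 V u 0).
rewrite add0r => H; apply: cvg_lim; first exact: norm_hausdorff.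
have {}H := has_dw_dnbhs t0 (H _); apply: H.
have := has_dwZ (@has_dw_id R (-1) 1 0) (@has_dw_cst R (-1) 1 V w 0).
by rewrite scaler0 addr0 scale1r.
Qed.

Definition admissible (R : realType) (n : nat) (a b : R)
    (gamma W : R -> 'rV[R]_n) : Prop :=
  [/\ smooth a b W, compactly_supported a b W & forall x, x \in `[a, b] ->
    dot (derive_within a b W x) (derive_within a b gamma x) = 0].

(** The derivative of the energy is the same for all variations with field W. The linear variation
    guarantees that there is one, so that criticality yields the weak equation. *)
Lemma elasticP (R : realType) (n : nat) (a b : R) (rho : R -> R^o)
    (gamma : R -> 'rV[R]_n) : a < b -> arc_length_parametrized a b gamma ->
  smooth a b rho ->
  elastic a b rho gamma <->
  forall W, admissible a b gamma W ->
    \int[@lebesgue_measure R]_(x in `[a, b])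
      (rho x * dot (nderive_within a b 2 gamma x) (nderive_within a b 2 W x)) = 0.
Proof.
move=> hab al srho; split=> [[_ el] W [sW cW orth]|H].
  have sv := linear_variation hab al sW orth.
  have dv x (xab : x \in `[a, b]) := derive1_linear_variation (gamma x) (W x).
  have [_ E0] := el W sW cW orth _ _ sv dv.
  have [_ E1] := is_derive_bending_energy hab al srho sW orth sv dv.
  by rewrite -[LHS]E1 E0.
split=> // W sW cW orth eps Gamma sv dv.
have := is_derive_bending_energy hab al srho sW orth sv dv.
by rewrite [X in is_derive _ _ _ X]H.
Qed.

(** * Vanishing near the endpoints and compact support *)

Section compact_support.
Context (R : realType) (V : normedModType R) (a b : R).
Hypothesis hab : a < b.

(** Vanishing on a neighbourhood, not just at the endpoint, is what also kills the derivative
    there. *)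
Lemma compactly_supported_near0 (f : R -> V) x : compactly_supported a b f ->
  x \notin `]a, b[ -> \forall y \near x, y \in `[a, b] -> f y = 0.
Proof.
move=> [_ sub] xab.
have : ~ closure [set x | x \in `[a, b] /\ f x != 0] x.
  by move=> /sub /=; apply/negP.
move=> /existsNP[B] /not_implyP[xB] /set0P/negP/negPn/eqP B0.
apply: filterS xB => y By yab; apply/eqP/negPn/negP => fy0.
by have : set0 y by rewrite -B0; split.
Qed.

Lemma near0_derive (f : R -> V) x : x \in `[a, b] -> smooth a b f ->
  (\forall y \near x, y \in `[a, b] -> f y = 0) ->
  f x = 0 /\ derive_within a b f x = 0.
Proof.
move=> xab sf f0; have fx0 : f x = 0 by exact: (nbhs_singleton f0 xab).
split=> //; apply: (has_dwE hab xab); rewrite /has_dw fx0.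
apply: (@cvg_near_eq _ _ _ (fun=> 0 : V)); first exact: cvg_cst.
case: f0 => e /= e0 H; exists e => //= y xy yx yab.
by rewrite H// subr0 scaler0.
Qed.

Lemma zero_compactly_supported (f : R -> V) c d : a < c -> d < b ->
  (forall x, x \in `[a, b] -> x <= c \/ d <= x -> f x = 0) ->
  compactly_supported a b f.
Proof.
move=> ac db f0; rewrite /compactly_supported /=.
have sub : closure [set x | x \in `[a, b] /\ f x != 0] `<=` `[c, d].
  rewrite [X in _ `<=` X](_ : _ = closure `[c, d]); last first.
    by apply/closure_id; exact: itv_closed.
  apply: closureS.
  move=> x /= [xab fx]; rewrite in_itv /=; apply/andP; split.
    rewrite leNgt; apply/negP => /ltW xc.
    by move: fx; rewrite f0 ?eqxx//; left.
  rewrite leNgt; apply/negP => /ltW dx.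
  by move: fx; rewrite f0 ?eqxx//; right.
split; first exact: (subclosed_compact (@closed_closure _ _) (@segment_compact _ c d)).
move=> x /sub /=; rewrite !in_itv /= => /andP[cx xd].
by rewrite (lt_le_trans ac cx) (le_lt_trans xd db).
Qed.

End compact_support.

(** * Euler-Lagrange equation *)


(** Induction on the number of constraints. Linearity is asked only on the subspace [S], because the
    integrals in play are additive only on integrable functions. Indexing [M] by [nat] keeps the
    family fixed as [n] grows. *)
Lemma lagrange_multipliers (K : fieldType) (V : lmodType K) (S : V -> Prop)
    (n : nat) (M : nat -> V -> K) (L : V -> K) :
  (forall k u v, S u -> S v -> S (u + k *: v)) ->
  (forall i k u v, S u -> S v -> M i (u + k *: v) = M i u + k * M i v) ->
  (forall k u v, S u -> S v -> L (u + k *: v) = L u + k * L v) ->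
  (forall v, S v -> (forall i, (i < n)%N -> M i v = 0) -> L v = 0) ->
  exists c : nat -> K, forall v, S v -> L v = \sum_(i < n) c i * M i v.
Proof.
move=> Slin Mlin; elim: n L => [|n ih] L Llin L0.
  by exists (fun=> 0) => v Sv; rewrite big_ord0 L0.
have [[w [Sw Mw Mnw]]|noW] := pselect (exists w,
    [/\ S w, forall i, (i < n)%N -> M i w = 0 & M n w != 0]); last first.
  (* Constraint [n] already follows from the earlier ones, so it receives the multiplier 0. *)
  have [|c Hc] := ih L Llin.
    move=> v Sv Mv; apply: L0 => // i.
    rewrite ltnS leq_eqVlt => /predU1P[->|]; last exact: Mv.
    by apply/eqP/negPn/negP => Mnv; apply: noW; exists v; split.
  exists (fun i => if (i < n)%N then c i else 0) => v Sv.
  rewrite big_ord_recr /= ltnn mul0r addr0 (Hc v Sv).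
  by apply: eq_bigr => i _; rewrite ltn_ord.
(* The multiplier of [M n] is forced by [w]. To see that [L'] vanishes on the kernel of the first
   [n] constraints, correct [v] by a multiple of [w] so that [M n] vanishes as well. *)
pose L' v := L v - L w / M n w * M n v.
have [k u v Su Sv|v Sv Mv|c Hc] := ih L'.
- by rewrite /L' Llin// Mlin//; ring.
- have Sz : S (v + (- (M n v / M n w)) *: w) by exact: Slin.
  have Lz : L (v + (- (M n v / M n w)) *: w) = 0.
    apply: L0 => // i; rewrite ltnS leq_eqVlt => /predU1P[->|ltin].
      by rewrite Mlin// mulNr divfK// subrr.
    by rewrite Mlin// (Mv i ltin) (Mw i ltin) mulr0 addr0.
  by rewrite /L' -[RHS]Lz Llin//; ring.
exists (fun i => if (i < n)%N then c i else L w / M n w) => v Sv.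
rewrite big_ord_recr /= ltnn.
under eq_bigr do rewrite ltn_ord.
by rewrite -Hc// /L' subrK.
Qed.

Section euler_lagrange.
Context (R : realType) (n : nat) (a b : R).
Hypothesis hab : a < b.
Variables (gamma : R -> 'rV[R]_n) (rho : R -> R^o).
Hypotheses (al : arc_length_parametrized a b gamma) (srho : smooth a b rho).
Notation D := (@derive_within R 'rV[R]_n a b).
Notation mu := (@lebesgue_measure R).
Let T := D gamma.
Let rho' : R -> R^o := @derive_within R R^o a b rho.
Let P x := rho' x *: D T x + rho x *: D (D T) x.

Let sT : smooth a b T. Proof. by have [[sg _] _] := al; exact: smooth_derive. Qed.
Let sT' : smooth a b (D T). Proof. exact: smooth_derive sT. Qed.
Let sT'' : smooth a b (D (D T)). Proof. exact: smooth_derive sT'. Qed.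
Let srho' : smooth a b rho'. Proof. exact: smooth_derive srho. Qed.
Let sP : smooth a b P.
Proof. exact: (smoothD hab (smoothZ hab srho' sT') (smoothZ hab srho sT'')). Qed.

Let dP x : x \in `[a, b] -> has_dw a b (fun y => rho y *: D T y) x (P x).
Proof.
by move=> xab; exact: (has_dwZ (smooth_has_dw srho xab) (smooth_has_dw sT' xab)).
Qed.

(** The Euler-Lagrange equation integrated once: [P] is (rho T')', [c] a constant force, and [m] the
    tangential reaction to the length constraint. *)
Definition force_balance : Prop := exists (c : 'rV[R]_n) (m : R -> R^o),
  smooth a b m /\ forall x, x \in `[a, b] -> P x = c + m x *: T x.

Lemma force_balance_weak (W : R -> 'rV[R]_n) :
  force_balance -> admissible a b gamma W ->
  \int[mu]_(x in `[a, b]) (rho x * dot (D T x) (D (D W) x)) = 0.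
Proof.
move=> [c [m [sm Pcm]]] [sW cW orth]; have sW' := smooth_derive sW.
have sW'' := smooth_derive sW'.
have aab : a \in `[a, b] by rewrite in_itv /= lexx ltW.
have bab : b \in `[a, b] by rewrite in_itv /= lexx ltW.
have aoo : a \notin `]a, b[ by rewrite in_itv /= ltxx.
have boo : b \notin `]a, b[ by rewrite in_itv /= ltxx andbF.
have [Wa W'a] := near0_derive hab aab sW (compactly_supported_near0 cW aoo).
have [Wb W'b] := near0_derive hab bab sW (compactly_supported_near0 cW boo).
have dot0 (u u0 v v0 : 'rV[R]_n) : u0 = 0 -> v0 = 0 -> dot u u0 - dot v v0 = 0.
  by move=> -> ->; rewrite !dot0r subrr.
(* A primitive of the integrand: the additional term <P - c, W'> = m <T, W'> of its derivative is
   zero. It vanishes at both ends together with W and W'. *)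
pose F x : R^o := dot (rho x *: D T x) (D W x) - dot c (W x).
rewrite (@Rintegral_FTC2 R a b hab _ F).
- have Fa : F a = 0 := dot0 _ _ _ _ W'a Wa.
  have Fb : F b = 0 := dot0 _ _ _ _ W'b Wb.
  by rewrite Fa Fb subrr.
- exact: smooth_continuous (smoothM hab srho (smooth_dot hab sT' sW'')).
move=> x xab.
have H := has_dwB (has_dw_dot (dP xab) (smooth_has_dw sW' xab))
  (has_dw_dot (@has_dw_cst R a b 'rV[R]_n c x) (smooth_has_dw sW xab)).
have E (t t' w w' y p : 'rV[R]_n) (r k : R) : dot w' t = 0 -> p = c + k *: t ->
    r * dot t' y = dot p w' + dot (r *: t') y - (dot 0 w + dot c w').
  by move=> w't ->; rewrite !(dotDl, dotZl) dot0l (dotC t) w't; ring.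
by rewrite (E _ _ (W x) _ _ _ _ _ (orth x xab) (Pcm x xab)).
Qed.

(** The test space for Y = W', without the zero mean. Explicit bounds c < d make it visibly stable
    under sums and let primitives be constant on [a, c] and [d, b]. *)
Let S (Y : R -> 'rV[R]_n) : Prop := [/\ smooth a b Y,
  forall x, x \in `[a, b] -> dot (Y x) (T x) = 0 &
  exists c d, [/\ a < c, c < d, d < b & forall x, x \in `[a, b] ->
    x <= c \/ d <= x -> Y x = 0]].

(** Zero mean makes the primitive return to its initial value, so after subtracting that value it
    vanishes on both outer pieces, where it is constant. *)
Lemma admissible_antiderivative (Y : R -> 'rV[R]_n) : S Y ->
  (forall i, \int[mu]_(x in `[a, b]) Y x 0 i = 0) ->
  exists2 W, admissible a b gamma W & {in `[a, b], D W =1 Y}.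
Proof.
move=> [sY orth [c [d [ac cd db Y0]]]] iY.
have aab : a \in `[a, b] by rewrite in_itv /= lexx ltW.
have bab : b \in `[a, b] by rewrite in_itv /= lexx ltW.
have [F FY] := antiderivative_rV hab (smooth_continuous sY).
have Fba : F b = F a.
  apply/rowP => i; apply/eqP; rewrite -subr_eq0 -(iY i); apply/eqP/esym.
  apply: (@Rintegral_FTC2 R a b hab (fun x => Y x 0 i) (fun x => F x 0 i)).
    exact: (@smooth_continuous R a b R^o _ (@smooth_coord R a b hab n Y i sY)).
  by move=> x xab; exact: (@has_dw_coord R a b n F x (Y x) i (FY x xab)).
have FW x : x \in `[a, b] -> has_dw a b (fun x => F x - F a) x (Y x).
  move=> xab; rewrite -[Y x]subr0.
  exact: (has_dwB (FY x xab) (@has_dw_cst R a b _ (F a) x)).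
have DW : {in `[a, b], D (fun x => F x - F a) =1 Y}.
  by move=> x xab; exact: (has_dwE hab xab (FW x xab)).
exists (fun x => F x - F a); last exact: DW.
split.
- exact: (has_dw_smooth hab FW sY).
- apply: (zero_compactly_supported ac db) => x xab [xc|dx];
    apply/eqP; rewrite subr_eq0; apply/eqP.
    have sub : `[a, c] `<=` `[a, b].
      by apply: subset_itvl; rewrite bnd_simp ltW// (lt_trans cd).
    apply: (has_dw0_cst_rV (f := F) (a := a) (b := c));
      last by rewrite in_itv /= xc (itvP xab).
    move=> y yac; have := has_dw_subitv sub (FY y (sub y yac)).
    by rewrite Y0//; [exact: sub|left; rewrite (itvP yac)].
  have sub : `[d, b] `<=` `[a, b].
    by apply: subset_itvr; rewrite bnd_simp ltW// (lt_trans ac).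
  have F0 y : y \in `[d, b] -> has_dw d b F y 0.
    move=> ydb; have := has_dw_subitv sub (FY y (sub y ydb)).
    by rewrite Y0//; [exact: sub|right; rewrite (itvP ydb)].
  rewrite -Fba (has_dw0_cst_rV F0); last by rewrite in_itv /= dx (itvP xab).
  by rewrite (has_dw0_cst_rV F0)// in_itv /= lexx ltW.
- by move=> x xab; rewrite (DW x xab) (orth x xab).
Qed.

Let pairing (u Y : R -> 'rV[R]_n) : R := \int[mu]_(x in `[a, b]) dot (u x) (Y x).

Let integrable_dot (u Y : R -> 'rV[R]_n) : smooth a b u -> smooth a b Y ->
  mu.-integrable `[a, b] (EFin \o (fun x => dot (u x) (Y x))).
Proof.
move=> su sY; apply: (within_continuous_integrable (f := fun x => dot (u x) (Y x))).
exact: (@smooth_continuous R a b R^o _ (smooth_dot hab su sY)).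
Qed.

Lemma pairing_linear (u Y Z : R -> 'rV[R]_n) (k : R) :
  smooth a b u -> smooth a b Y -> smooth a b Z ->
  pairing u (Y + k *: Z) = pairing u Y + k * pairing u Z.
Proof.
move=> su sY sZ; have iY := integrable_dot su sY.
have iZ := integrable_dot su sZ.
have skZ : smooth a b (fun x => k *: Z x) := @smoothZr R a b hab _ k Z sZ.
have ikZ : mu.-integrable `[a, b] (EFin \o (fun x => k * dot (u x) (Z x))).
  rewrite (_ : (fun x => _) = fun x => dot (u x) (k *: Z x)).
    exact: integrable_dot.
  by apply/funext => x; rewrite dotZr.
rewrite /pairing -RintegralZl; [|exact: measurable_itv|exact: iZ].
rewrite -RintegralD; [|exact: measurable_itv|exact: iY|exact: ikZ].
by apply: eq_Rintegral => x _; rewrite -dotZr -dotDr.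
Qed.

Let S_linear (k : R) (Y Z : R -> 'rV[R]_n) : S Y -> S Z -> S (Y + k *: Z).
Proof.
move=> [sY oY [c [d [ac cd db Y0]]]] [sZ oZ [c' [d' [ac' cd' db' Z0]]]]; split.
- exact: (smoothD hab sY (@smoothZr R a b hab _ k Z sZ)).
- move=> x xab; rewrite [LHS](_ : _ = dot (Y x + k *: Z x) (T x))//.
  by rewrite dotDl dotZl (oY x xab) (oZ x xab) mulr0 addr0.
- exists (Num.min c c'), (Num.max d d'); split.
  + by rewrite lt_min ac ac'.
  + by rewrite gt_min lt_max cd.
  + by rewrite gt_max db db'.
  + move=> x xab H.
    rewrite [LHS](_ : _ = Y x + k *: Z x)// Y0 ?Z0 ?scaler0 ?addr0//.
      by case: H; rewrite ?le_min ?ge_max => /andP[_ ?]; [left|right].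
    by case: H; rewrite ?le_min ?ge_max => /andP[? _]; [left|right].
Qed.

(** Pairing with a constant is the dot product with the increment of a primitive, hence linear in
    the constant. *)
Let pairing_cst (c : 'rV[R]_n) (Y : R -> 'rV[R]_n) : smooth a b Y ->
  pairing (fun=> c) Y = \sum_i c 0 i * pairing (fun=> delta_mx 0 i) Y.
Proof.
move=> sY; have [F FY] := antiderivative_rV hab (smooth_continuous sY).
have E u : pairing (fun=> u) Y = dot u (F b - F a).
  rewrite dotDr dotNr.
  apply: (@Rintegral_FTC2 R a b hab (fun x => dot u (Y x)) (fun x => dot u (F x))).
    exact: (@smooth_continuous R a b R^o _
      (smooth_dot hab (@smooth_cst R a b hab _ u) sY)).
  move=> x xab; rewrite -[dot u (Y x)]add0r -(dot0l (F x)).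
  exact: (has_dw_dot (@has_dw_cst R a b _ u x) (FY x xab)).
by rewrite E {1}/dot; apply: eq_bigr => i _; rewrite E dot_delta.
Qed.

(** Let W be a primitive of Y. Integrating by parts moves the derivative from rho T' onto Y = W',
    where the weak equation for W applies; Y vanishes at the ends. *)
Lemma weak_kernel (Y : R -> 'rV[R]_n) :
  (forall W, admissible a b gamma W ->
    \int[mu]_(x in `[a, b]) (rho x * dot (D T x) (D (D W) x)) = 0) ->
  S Y -> (forall i, pairing (fun=> delta_mx 0 i) Y = 0) -> pairing P Y = 0.
Proof.
move=> weak SY Y0; have [sY oY [c [d [ac cd db Yout]]]] := SY.
have aab : a \in `[a, b] by rewrite in_itv /= lexx ltW.
have bab : b \in `[a, b] by rewrite in_itv /= lexx ltW.
have iY i : \int[mu]_(x in `[a, b]) Y x 0 i = 0.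
  by rewrite -[RHS](Y0 i); apply: eq_Rintegral => x _; rewrite dot_delta.
have [W aW DW] := admissible_antiderivative SY iY.
have sDY := smooth_derive sY.
have sr : smooth a b (fun x => rho x *: D T x) := smoothZ hab srho sT'.
have i1 := integrable_dot sP sY; have i2 := integrable_dot sr sDY.
have Yab : Y a = 0 /\ Y b = 0.
  by split; [apply: Yout => //; left; exact: ltW|apply: Yout => //; right; exact: ltW].
have H : \int[mu]_(x in `[a, b])
    (dot (P x) (Y x) + dot (rho x *: D T x) (D Y x)) = 0.
  pose Q x : R^o := dot (rho x *: D T x) (Y x).
  have Q0 y : Y y = 0 -> Q y = 0 by rewrite /Q => ->; exact: dot0r.
  rewrite (@Rintegral_FTC2 R a b hab _ Q).
  - by rewrite (Q0 a Yab.1) (Q0 b Yab.2) subrr.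
  - exact: (@smooth_continuous R a b R^o _ (@smoothD R a b hab R^o _ _
      (smooth_dot hab sP sY) (smooth_dot hab sr sDY))).
  - by move=> x xab; exact: (has_dw_dot (dP xab) (smooth_has_dw sY xab)).
move: H; rewrite RintegralD; [|exact: measurable_itv|exact: i1|exact: i2].
rewrite [X in _ + X](_ : _ = 0) ?addr0//.
rewrite -[RHS](weak W aW); apply: eq_Rintegral => x; rewrite inE /= => xab.
by rewrite dotZl (eq_derive_within DW xab).
Qed.

Lemma weak_force_balance :
  (forall W, admissible a b gamma W ->
    \int[mu]_(x in `[a, b]) (rho x * dot (D T x) (D (D W) x)) = 0) ->
  force_balance.
Proof.
move=> weak.
(* The coordinate means of [Y], indexed by [nat] for [lagrange_multipliers]; the default 0 is met
   only for [i >= n], outside its sum. *)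
pose M (i : nat) (Y : R -> 'rV[R]_n) : R :=
  if insub i is Some j then pairing (fun=> delta_mx 0 (j : 'I_n)) Y else 0.
have Mj (j : 'I_n) Y : M j Y = pairing (fun=> delta_mx 0 j) Y by rewrite /M valK.
have sc (u : 'rV[R]_n) : smooth a b (fun=> u) := @smooth_cst R a b hab _ u.
have Mlin i k Y Z : S Y -> S Z -> M i (Y + k *: Z) = M i Y + k * M i Z.
  move=> [sY _ _] [sZ _ _]; rewrite /M; case: insub => [j|]; last by rewrite mulr0 addr0.
  exact: (@pairing_linear _ Y Z k (sc _) sY sZ).
have Llin k Y Z : S Y -> S Z -> pairing P (Y + k *: Z) = pairing P Y + k * pairing P Z.
  by move=> [sY _ _] [sZ _ _]; exact: (@pairing_linear P Y Z k sP sY sZ).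
have ker Y : S Y -> (forall i, (i < n)%N -> M i Y = 0) -> pairing P Y = 0.
  by move=> SY MY; apply: (weak_kernel weak SY) => j; rewrite -Mj MY.
have [c0 Hc0] := lagrange_multipliers S_linear Mlin Llin ker.
pose c : 'rV[R]_n := \row_i c0 i.
(* The multipliers form the vector [c], and [f] annihilates [S]. It remains to show that its normal
   part [fp] vanishes, [m] being the tangential one. *)
pose f x := P x - c; pose m x : R^o := dot (f x) (T x).
pose fp x := f x - m x *: T x.
have sf : smooth a b f := smoothB hab sP (sc c).
have sm : smooth a b m := smooth_dot hab sf sT.
have sfp : smooth a b fp := smoothB hab sf (smoothZ hab sm sT).
have fpT x : x \in `[a, b] -> dot (fp x) (T x) = 0.
  move=> xab; have := arc_length_dotT al xab; rewrite -/(T x).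
  have E (u t : 'rV[R]_n) : dot t t = 1 -> dot (u - dot u t *: t) t = 0.
    by move=> tt; rewrite dotDl dotNl dotZl tt mulr1 subrr.
  exact: E.
have ffp x : x \in `[a, b] -> dot (f x) (fp x) = dot (fp x) (fp x).
  move=> xab; have E (u v t : 'rV[R]_n) (k : R) : u = v + k *: t -> dot v t = 0 ->
      dot u v = dot v v.
    by move=> -> vt; rewrite dotDl dotZl (dotC t) vt mulr0 addr0.
  by apply: (E _ _ (T x) (m x) _ (fpT x xab)); rewrite /fp subrK.
have fY Y : S Y -> pairing f Y = 0.
  move=> SY; have [sY _ _] := SY; have H := Hc0 Y SY.
  rewrite /pairing [LHS](_ : _ = pairing P Y - pairing (fun=> c) Y).
    rewrite H (pairing_cst c sY); apply/eqP; rewrite subr_eq0; apply/eqP.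
    by apply: eq_bigr => i _; rewrite mxE Mj.
  have i1 := integrable_dot sP sY; have i2 := integrable_dot (sc c) sY.
  rewrite /pairing -RintegralB; [|exact: measurable_itv|exact: i1|exact: i2].
  by apply: eq_Rintegral => x _; rewrite /f dotDl dotNl.
have fp0 x : x \in `]a, b[ -> dot (fp x) (fp x) = 0.
  rewrite in_itv /= => /andP[ax xb].
  have xab : x \in `[a, b] by rewrite in_itv /= !ltW.
  (* The midpoints keep the support of the bump around [x] strictly inside the segment, as [S]
     demands. *)
  have [phi [sphi phi_gt0 phi0]] := bump_exists ((a + x) / 2) ((x + b) / 2) hab.
  have phi_ge0 y : 0 <= phi y.
    have [yc|cy] := leP y ((a + x) / 2); first by rewrite phi0//; left.
    have [dy|yd] := leP ((x + b) / 2) y; first by rewrite phi0//; right.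
    by rewrite ltW// phi_gt0// cy.
  have SY : S (fun y => phi y *: fp y).
    split; first exact: (smoothZ hab sphi sfp).
      by move=> y yab; rewrite dotZl (fpT y yab) mulr0.
    exists ((a + x) / 2), ((x + b) / 2); split; [lra..|].
    by move=> y _ /phi0 ->; rewrite scale0r.
  have E y : y \in `[a, b] -> dot (f y) (phi y *: fp y) = phi y * dot (fp y) (fp y).
    by move=> yab; rewrite dotZr (ffp y yab).
  have cY : {within `[a, b], continuous (fun y => dot (f y) (phi y *: fp y) : R^o)}.
    exact: (@smooth_continuous R a b R^o _ (smooth_dot hab sf (smoothZ hab sphi sfp))).
  have pos y : y \in `[a, b] -> 0 <= dot (f y) (phi y *: fp y).
    by move=> yab; rewrite (E y yab) mulr_ge0// dot_ge0.
  (* The pairing is the integral of phi |fp|^2, which is nonnegative and continuous; since phi is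
     positive at [x], [fp] is zero there. *)
  have := Rintegral_ge0_eq0 hab cY pos (fY _ SY) xab.
  rewrite /= (E x xab) => /eqP; rewrite mulf_eq0 gt_eqF /=; first by move/eqP.
  by apply: phi_gt0; apply/andP; split; lra.
exists c, m; split; first exact: sm.
move=> x xab.
(* The bumps only reach interior points; continuity settles the two endpoints. *)
have cfp := @smooth_continuous R a b R^o _ (smooth_dot hab sfp sfp).
have /eqP := within_continuous_eq0 hab cfp fp0 xab.
rewrite /= dot_eq0 /fp /f => /eqP H.
have E (p u v : 'rV[R]_n) : p - u - v = 0 -> p = u + v.
  by move=> /eqP; rewrite -addrA -opprD subr_eq0 => /eqP.
exact: E.
Qed.

End euler_lagrange.

(* The bending gradient is the derivative of (rho T')' + 3/2 rho <T', T'> T. *)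
Lemma gradient_identity (R : realType) (n : nat) (t t1 t2 t3 : 'rV[R]_n)
    (r r1 r2 k k1 : R) :
  r2 *: t1 + r1 *: t2 + (r1 *: t2 + r *: t3) +
    ((3 / 2 * (r1 * dot t1 t1 + r * (dot t2 t1 + dot t1 t2)) - k1) *: t +
     (3 / 2 * (r * dot t1 t1) - k) *: t1) =
  r *: t3 + (3 * r * dot t2 t1) *: t + (3 / 2 * r * dot t1 t1) *: t1 + r2 *: t1
    + r1 *: (2 *: t2 + (3 / 2 * dot t1 t1) *: t) - k1 *: t - k *: t1.
Proof.
rewrite (dotC t1 t2); move: (dot t1 t1) (dot t2 t1) => d e.
by apply/rowP => i; rewrite !mxE; field.
Qed.

(** * From the integrated equation to the equation with a multiplier *)

Section multiplier.
Context (R : realType) (n : nat) (a b : R).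
Hypothesis hab : a < b.
Variables (gamma : R -> 'rV[R]_n) (rho : R -> R^o).
Hypotheses (al : arc_length_parametrized a b gamma) (srho : smooth a b rho).
Notation D := (@derive_within R 'rV[R]_n a b).
Notation d := (@derive_within R R^o a b).
Let T := D gamma.

(** Both sides say that P + (q - k) T is constant, with k = m + q: one is the integrated form, the
    other the derivative. *)
Lemma force_balanceP : force_balance a b gamma rho <->
  exists k : R -> R^o, smooth a b k /\ forall x, x \in `[a, b] ->
    bending_gradient a b rho T x - d k x *: T x - k x *: D T x = 0.
Proof.
have sT : smooth a b T by have [[sg _] _] := al; exact: smooth_derive.
have sT' : smooth a b (D T) := smooth_derive sT.
have sT'' : smooth a b (D (D T)) := smooth_derive sT'.
have srho' : smooth a b (d rho) := smooth_derive srho.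
pose P x := d rho x *: D T x + rho x *: D (D T) x.
pose q x : R^o := 3 / 2 * (rho x * dot (D T x) (D T x)).
have sq : smooth a b q.
  exact: (@smoothZr R a b hab R^o (3 / 2) _ (smoothM hab srho (smooth_dot hab sT' sT'))).
have dP x : x \in `[a, b] -> has_dw a b P x
    (d (d rho) x *: D T x + d rho x *: D (D T) x +
     (d rho x *: D (D T) x + rho x *: D (D (D T)) x)).
  move=> xab; apply: has_dwD.
    exact: (has_dwZ (smooth_has_dw srho' xab) (smooth_has_dw sT' xab)).
  exact: (has_dwZ (smooth_has_dw srho xab) (smooth_has_dw sT'' xab)).
have dq x : x \in `[a, b] -> has_dw a b q x
    (3 / 2 * (d rho x * dot (D T x) (D T x) +
      rho x * (dot (D (D T) x) (D T x) + dot (D T x) (D (D T) x))) : R^o).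
  move=> xab; apply: has_dwMr; apply: has_dwM; first exact: (smooth_has_dw srho xab).
  exact: (has_dw_dot (smooth_has_dw sT' xab) (smooth_has_dw sT' xab)).
have dPhi k x : smooth a b k -> x \in `[a, b] ->
    has_dw a b (fun y => P y + (q y - k y) *: T y) x
      (bending_gradient a b rho T x - d k x *: T x - k x *: D T x).
  move=> sk xab; rewrite /bending_gradient -gradient_identity.
  apply: (has_dwD (dP x xab)); apply: has_dwZ; last exact: (smooth_has_dw sT xab).
  exact: (has_dwB (dq x xab) (smooth_has_dw sk xab)).
split=> [[c [m [sm Pm]]]|[k [sk Hk]]].
  have sk : smooth a b (fun x => m x + q x) := @smoothD R a b hab R^o _ _ sm sq.
  exists (fun x => m x + q x); split; first exact: sk.
  move=> x xab; apply: (has_dw_uniq hab xab (dPhi _ x sk xab)).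
  have E : {in `[a, b], (fun=> c) =1 fun y => P y + (q y - (m y + q y)) *: T y}.
    move=> y yab; have H (p t : 'rV[R]_n) (u v : R) : p = c + u *: t ->
        c = p + (v - (u + v)) *: t.
      by move=> ->; rewrite opprD addrCA subrr addr0 scaleNr addrK.
    exact: H (Pm y yab).
  exact: (has_dw_eq xab E (@has_dw_cst R a b _ c x)).
have Phi0 x (xab : x \in `[a, b]) : has_dw a b (fun y => P y + (q y - k y) *: T y) x 0.
  by rewrite -(Hk x xab); exact: dPhi.
(* The constant vector is read off at [a]. *)
exists (P a + (q a - k a) *: T a), (fun x => k x - q x); split.
  exact: (@smoothB R a b hab R^o _ _ sk sq).
move=> x xab; have H (p t c : 'rV[R]_n) (u v : R) : p + (u - v) *: t = c ->
    p = c + (v - u) *: t.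
  by move=> <-; rewrite -addrA -scalerDl addrA subrK subrr scale0r addr0.
exact: H (has_dw0_cst_rV Phi0 xab).
Qed.

Lemma elastic_force_balance : elastic a b rho gamma <-> force_balance a b gamma rho.
Proof.
rewrite (elasticP hab al srho); split=> [weak|fb W aW].
  exact: (weak_force_balance hab al srho weak).
exact: (force_balance_weak hab al srho fb aW).
Qed.

End multiplier.

Theorem theorem3p5 (R : realType) (n : nat) (hn : (2 <= n)%N) (a b : R)
    (hab : a < b) (gamma : R -> 'rV[R]_n) (rho : R -> R)
    (hgamma : arc_length_parametrized a b gamma)
    (hrho : bending_stiffness a b rho) :
  let T := derive_within a b gamma in
  let dT k := nderive_within a b k T in
  let dgamma k := nderive_within a b k gamma in
  let drho k := nderive_within_R a b k rho in
  [/\ elastic a b rho gamma <->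
      (exists Lambda : R -> R, smooth a b (Lambda : R -> R^o) /\
        forall x : R, x \in `[a, b] ->
          bending_gradient a b rho T x
          - (2 * nderive_within_R a b 1 Lambda x) *: T x
          - (2 * Lambda x) *: dT 1%N x = 0),
      elastic a b rho gamma <->
      (exists Lambda : R -> R, smooth a b (Lambda : R -> R^o) /\
        forall x : R, x \in `[a, b] ->
          rho x *: dT 3%N x
          + (3 * rho x * dot (dT 1%N x) (dT 2%N x)) *: T x
          + (3 / 2 * rho x * dot (dT 1%N x) (dT 1%N x)) *: dT 1%N x
          + drho 2%N x *: dT 1%N x
          + (2 * drho 1%N x) *: dT 2%N x
          + (3 / 2 * drho 1%N x * dot (dT 1%N x) (dT 1%N x)) *: T x
          - nderive_within_R a b 1 Lambda x *: T x
          - Lambda x *: dT 1%N x = 0) &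
      elastic a b rho gamma <->
      (exists Lambda : R -> R, smooth a b (Lambda : R -> R^o) /\
        forall x : R, x \in `[a, b] ->
          rho x *: dgamma 4%N x
          + (3 * rho x * dot (dgamma 3%N x) (dgamma 2%N x)) *: dgamma 1%N x
          + (3 / 2 * rho x * dot (dgamma 2%N x) (dgamma 2%N x))
              *: dgamma 2%N x
          + drho 2%N x *: dgamma 2%N x
          + (2 * drho 1%N x) *: dgamma 3%N x
          + (3 / 2 * drho 1%N x * dot (dgamma 2%N x) (dgamma 2%N x))
              *: dgamma 1%N x
          - nderive_within_R a b 1 Lambda x *: dgamma 1%N x
          - Lambda x *: dgamma 2%N x = 0)].
Proof.
have [srho _] := hrho; move=> T dT dgamma drho.
have E0 : elastic a b rho gamma <-> exists k : R -> R^o, smooth a b k /\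
    forall x, x \in `[a, b] ->
      bending_gradient a b rho T x - nderive_within_R a b 1 k x *: T x
        - k x *: dT 1%N x = 0.
  rewrite (elastic_force_balance hab hgamma srho).
  exact: (force_balanceP hab hgamma srho).
have E (t t1 t2 t3 : 'rV[R]_n) (r r1 r2 : R) :
    r *: t3 + (3 * r * dot t2 t1) *: t + (3 / 2 * r * dot t1 t1) *: t1 + r2 *: t1
    + r1 *: (2 *: t2 + (3 / 2 * dot t1 t1) *: t) =
    r *: t3 + (3 * r * dot t2 t1) *: t + (3 / 2 * r * dot t1 t1) *: t1 + r2 *: t1
    + (2 * r1) *: t2 + (3 / 2 * r1 * dot t1 t1) *: t.
  move: (dot t1 t1) (dot t2 t1) => d e.
  by apply/rowP => i; rewrite !mxE; field.
(* The form in T writes the product as <T', T''>, the form in gamma as <gamma''', gamma''>; hence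
   two versions, differing by symmetry of [dot]. *)
have E' (t t1 t2 t3 : 'rV[R]_n) (r r1 r2 : R) :
    r *: t3 + (3 * r * dot t2 t1) *: t + (3 / 2 * r * dot t1 t1) *: t1 + r2 *: t1
    + r1 *: (2 *: t2 + (3 / 2 * dot t1 t1) *: t) =
    r *: t3 + (3 * r * dot t1 t2) *: t + (3 / 2 * r * dot t1 t1) *: t1 + r2 *: t1
    + (2 * r1) *: t2 + (3 / 2 * r1 * dot t1 t1) *: t.
  by rewrite E (dotC t1 t2).
have Egrad x := E (T x) (dT 1%N x) (dT 2%N x) (dT 3%N x)
  (rho x) (drho 1%N x) (drho 2%N x).
have Egrad' x := E' (T x) (dT 1%N x) (dT 2%N x) (dT 3%N x)
  (rho x) (drho 1%N x) (drho 2%N x).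
have trans (u v w z : 'rV[R]_n) : u = v -> u - w - z = 0 -> v - w - z = 0 by move=> ->.
split.
(* Only the first form carries the factor 2, so [k = 2 Lambda] there; in the other two [k] is
   [Lambda] itself. *)
- rewrite E0; split=> [[k [sk Hk]]|[L [sL HL]]].
    have sL : smooth a b (fun x => 2^-1 * k x : R^o) := @smoothZr R a b hab R^o 2^-1 k sk.
    exists (fun x => 2^-1 * k x); split; first exact: sL.
    move=> x xab; rewrite -[RHS](Hk x xab) mulrA divff ?mul1r ?pnatr_eq0//.
    have -> : nderive_within_R a b 1 (fun x => 2^-1 * k x) x =
        2^-1 * nderive_within_R a b 1 k x.
      exact: (@has_dwE R a b hab R^o _ x _ xab
        (@has_dwMr R a b 2^-1 k x _ (@smooth_has_dw R a b R^o k x sk xab))).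
    by rewrite mulrA divff ?mul1r ?pnatr_eq0.
  have sk : smooth a b (fun x => 2 * L x : R^o) := @smoothZr R a b hab R^o 2 _ sL.
  exists (fun x => 2 * L x); split; first exact: sk.
  move=> x xab; rewrite -[RHS](HL x xab).
  have -> // : nderive_within_R a b 1 (fun x => 2 * L x) x =
      2 * nderive_within_R a b 1 L x.
  exact: (@has_dwE R a b hab R^o _ x _ xab
        (@has_dwMr R a b 2 L x _ (@smooth_has_dw R a b R^o L x sL xab))).
- rewrite E0; split=> -[k [sk Hk]]; exists k; (split; first exact: sk) => x xab.
    exact: (trans _ _ _ _ (Egrad' x) (Hk x xab)).
  exact: (trans _ _ _ _ (esym (Egrad' x)) (Hk x xab)).
(* For each concrete order the derivatives of [gamma] are convertible to those of [T] of one order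
   less, so the identity stated for [T] applies as it is. *)
- rewrite E0; split=> -[k [sk Hk]]; exists k; (split; first exact: sk) => x xab.
    exact: (trans _ _ _ _ (Egrad x) (Hk x xab)).
  exact: (trans _ _ _ _ (esym (Egrad x)) (Hk x xab)).
Qed.
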